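(* Let $R$ be an integral domain that is not a field, with integral closure $R'$. Then the following are equivalent. (1) $R$ is a Noetherian FAF-domain with $R:R'\neq (0)$. (2) There exist a Dedekind domain $T$, distinct maximal ideals $N_1,\dots,N_n$ of $T$, $a_1,\dots,a_n\in\mathbb N$ and unibranched ring extensions $D_i\subseteq T/N_i^{a_i}$ such that $T/N_i^{a_i}$ is a finite $D_i$-module for each $i$, and $R=\pi^{-1}\bigl(\prod_{i=1}^n D_i\bigr)$, where $\pi:T\to\prod_{i=1}^n (T/N_i^{a_i})$ is the canonical projection. (3) $R'$ is a Dedekind domain, and $R/(R:R')\to R'/(R:R')$ is a unibranched ring extension that is also a finite module extension. In particular, if (1) holds, then $R'$ is a finite $R$-module and, with $N_1,\dots,N_n$ as in (2), $\textnormal{AF-dim}(R)=\max_{1\le i\le n}\{\textnormal{AF-dim}(R_{N_i\cap R})\}$.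
   Context: All rings are commutative and unital. Let $R$ be an integral domain with quotient field $K$. For $R$-submodules $I,J$ of $K$, $I:J=\{x\in K\mid xJ\subseteq I\}$. $R'$ is the integral closure of $R$ in $K$. For $n\in\mathbb N$, a proper ideal $I$ of a ring $R$ is $n$-absorbing if whenever $a_1,\dots,a_{n+1}\in R$ and $a_1\cdots a_{n+1}\in I$, there is $i$ with $\prod_{j\neq i}a_j\in I$. $\textnormal{AF-dim}(R)$ is the minimum positive integer $n$ such that every proper ideal of $R$ is a finite product of $n$-absorbing ideals of $R$ ($\infty$ if no such $n$ exists). An FAF-domain is an integral domain $R$ with $\textnormal{AF-dim}(R)<\infty$. A ring extension $A\subseteq B$ is unibranched if for each prime ideal $P$ of $A$ there is exactly one prime ideal $Q$ of $B$ with $Q\cap A=P$. *)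

(* Defs.v *)
From HB Require Import structures.
From mathcomp Require Import all_boot all_order all_algebra.
From mathcomp Require Import boolp classical_sets constructive_ereal.

Set Implicit Arguments.
Unset Strict Implicit.
Unset Printing Implicit Defensive.

Import Order.TTheory GRing.Theory Num.Theory.
Local Open Scope classical_set_scope.
Local Open Scope ring_scope.

(* The ideals of ring_quotient are proper and live over nontrivial rings; here
   the unit ideal and the zero ring are needed: if R is integrally closed then
   R : R' = R and both R / (R : R') and R' / (R : R') are zero rings. *)
Record ideal (R : comPzRingType) := Ideal {
  ideal_set :> set R;
  ideal0 : ideal_set 0;
  idealD : forall x y, ideal_set x -> ideal_set y -> ideal_set (x + y);
  idealM : forall a x, ideal_set x -> ideal_set (a * x) }.

Lemma ideal_ext (R : comPzRingType) (I J : ideal R) :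
  I = J :> set R -> I = J.
Proof.
case: I J => [I I0 ID IM] [J J0 JD JM] /= IJ; subst J.
by congr Ideal; exact: Prop_irrelevance.
Qed.

Definition proper (R : comPzRingType) (I : ideal R) : Prop := ~ (I : set R) 1.

Section IdealOperations.
Variable R : comPzRingType.
Implicit Types I J : ideal R.

Program Definition unit_ideal : ideal R := @Ideal R setT _ _ _.

Definition ideal_mul_set I J : set R :=
  [set x | exists n (a b : 'I_n -> R),
     [/\ forall i, (I : set R) (a i), forall i, (J : set R) (b i)
       & x = \sum_i a i * b i]].

Lemma ideal_mul0 I J : ideal_mul_set I J 0.
Proof.
exists 0%N, (fun=> 0), (fun=> 0); split=> [i|i|]; [by case: i|by case: i|].
by rewrite big_ord0.
Qed.

Lemma ideal_mulD I J x y :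
  ideal_mul_set I J x -> ideal_mul_set I J y -> ideal_mul_set I J (x + y).
Proof.
move=> [n [a [b [Ia Jb ->]]]] [m [c [d [Ic Jd ->]]]].
pose cat (u : 'I_n -> R) (v : 'I_m -> R) (i : 'I_(n + m)) :=
  match split i with inl j => u j | inr j => v j end.
exists (n + m)%N, (cat a c), (cat b d); split.
- by move=> i; rewrite /cat; case: split.
- by move=> i; rewrite /cat; case: split.
- rewrite big_split_ord /cat /=.
  congr (_ + _); apply: eq_bigr => i _.
    by rewrite (unsplitK (inl i)).
  by rewrite (unsplitK (inr i)).
Qed.

Lemma ideal_mulM I J a x : ideal_mul_set I J x -> ideal_mul_set I J (a * x).
Proof.
move=> [n [b [c [Ib Jc ->]]]]; exists n, (fun i => a * b i), c; split=> //.
  by move=> i; apply: idealM.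
by rewrite mulr_sumr; apply: eq_bigr => i _; rewrite mulrA.
Qed.

Definition ideal_mul I J : ideal R :=
  Ideal (ideal_mul0 I J) (@ideal_mulD I J) (@ideal_mulM I J).

Definition ideal_exp I n : ideal R := iter n (ideal_mul I) unit_ideal.

End IdealOperations.

Section Comap.
Variables (A B : comPzRingType) (f : {rmorphism A -> B}) (J : ideal B).

Lemma comap0 : (f @^-1` J) 0.
Proof. by rewrite /preimage /= rmorph0; exact: ideal0. Qed.

Lemma comapD x y : (f @^-1` J) x -> (f @^-1` J) y -> (f @^-1` J) (x + y).
Proof. by rewrite /preimage /= rmorphD; exact: idealD. Qed.

Lemma comapM a x : (f @^-1` J) x -> (f @^-1` J) (a * x).
Proof. by rewrite /preimage /= rmorphM; exact: idealM. Qed.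

Definition ideal_comap : ideal A := Ideal comap0 comapD comapM.

End Comap.

Definition is_prime (R : comPzRingType) (P : ideal R) : Prop :=
  proper P /\ forall x y, (P : set R) (x * y) -> (P : set R) x \/ (P : set R) y.

Definition is_maximal (R : comPzRingType) (M : ideal R) : Prop :=
  proper M /\ forall J : ideal R, proper J -> M `<=` J -> J = M.

Record prime_ideal (R : comPzRingType) := PrimeIdeal {
  prime_ideal_val :> ideal R;
  prime_idealP : is_prime prime_ideal_val }.

Record maximal_ideal (R : comPzRingType) := MaximalIdeal {
  maximal_ideal_val :> ideal R;
  maximal_idealP : is_maximal maximal_ideal_val }.

Lemma maximal_is_prime (R : comPzRingType) (M : ideal R) :
  is_maximal M -> is_prime M.
Proof.
case=> M1 Mmax; split=> // x y Mxy.
pose S := [set z | exists m a, (M : set R) m /\ z = m + a * x].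
have S0 : S 0 by exists 0, 0; rewrite mul0r addr0; split=> //; apply: ideal0.
have SD u v : S u -> S v -> S (u + v).
  move=> [m [a [Mm ->]]] [m' [a' [Mm' ->]]]; exists (m + m'), (a + a').
  by rewrite mulrDl addrACA; split=> //; apply: idealD.
have SM c u : S u -> S (c * u).
  move=> [m [a [Mm ->]]]; exists (c * m), (c * a).
  by rewrite mulrDr mulrA; split=> //; apply: idealM.
have MS : (M : set R) `<=` Ideal S0 SD SM.
  by move=> m Mm; exists m, 0; rewrite mul0r addr0.
have [[m [a [Mm e1]]]|S1] := pselect (S 1).
  right; rewrite -[y]mul1r e1 mulrDl; apply: idealD.
    by rewrite mulrC; apply: idealM.
  by rewrite -mulrA; apply: idealM.
left; rewrite -(Mmax (Ideal S0 SD SM) S1 MS).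
by exists 0, 1; rewrite mul1r add0r; split=> //; apply: ideal0.
Qed.

Definition prime_of_maximal (R : comPzRingType) (M : maximal_ideal R) :
  prime_ideal R := PrimeIdeal (maximal_is_prime (maximal_idealP M)).

Lemma comap_is_prime (A B : comPzRingType) (f : {rmorphism A -> B})
  (Q : prime_ideal B) : is_prime (ideal_comap f Q).
Proof.
case: Q => Q [Q1 Qp]; split; first by rewrite /proper /= rmorph1.
by move=> x y /=; rewrite rmorphM; apply: Qp.
Qed.

Definition prime_comap (A B : comPzRingType) (f : {rmorphism A -> B})
  (Q : prime_ideal B) : prime_ideal A := PrimeIdeal (comap_is_prime f Q).

Section QuotientRing.
Variables (R : comPzRingType) (I : ideal R).

Definition ideal_pred : {pred R} := fun x => `[< (I : set R) x >].

Lemma ideal_pred_zmod : zmod_closed ideal_pred.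
Proof.
split=> [|x y]; first by apply/asboolP; exact: ideal0.
move=> /asboolP Ix /asboolP Iy; apply/asboolP; apply: idealD => //.
by rewrite -mulN1r; apply: idealM.
Qed.

HB.instance Definition _ := GRing.isZmodClosed.Build R ideal_pred ideal_pred_zmod.

Definition quot_ring := Quotient.quot (ideal_pred : zmodClosed R).

HB.instance Definition _ := GRing.Zmodule.on quot_ring.

Definition quot_pi (x : R) : quot_ring := \pi_(quot_ring)%qT x.
Definition quot_repr (x : quot_ring) : R := repr x.

Lemma quot_reprK : cancel quot_repr quot_pi.
Proof. by move=> x; apply: reprK. Qed.

Lemma quot_piP x y : quot_pi x = quot_pi y <-> (I : set R) (x - y).
Proof.
split=> [e|Ixy].
  apply/asboolP; rewrite -[`[< _ >]]/(x - y \in ideal_pred).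
  by rewrite (Quotient.idealrBE ideal_pred); apply/eqP.
apply/eqP; rewrite -(Quotient.idealrBE ideal_pred).
by apply/asboolP.
Qed.

Lemma quot_pi_zmod_morphism : zmod_morphism quot_pi.
Proof. by move=> x y; rewrite /quot_pi !piE. Qed.

Definition quot_one : quot_ring := quot_pi 1.
Definition quot_mul (x y : quot_ring) : quot_ring :=
  quot_pi (quot_repr x * quot_repr y).

Lemma quot_pi_mul x y : quot_mul (quot_pi x) (quot_pi y) = quot_pi (x * y).
Proof.
apply/quot_piP; set x' := quot_repr _; set y' := quot_repr _.
have Ix : (I : set R) (x' - x) by apply/quot_piP; rewrite quot_reprK.
have Iy : (I : set R) (y' - y) by apply/quot_piP; rewrite quot_reprK.
have -> : x' * y' - x * y = y' * (x' - x) + x * (y' - y).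
  by rewrite !mulrBr addrA [y' * x']mulrC [y' * x]mulrC subrK.
by apply: idealD; apply: idealM.
Qed.

Lemma quot_mulA : associative quot_mul.
Proof.
move=> x y z; rewrite -[x]quot_reprK -[y]quot_reprK -[z]quot_reprK.
by rewrite !quot_pi_mul mulrA.
Qed.

Lemma quot_mulC : commutative quot_mul.
Proof. by move=> x y; rewrite /quot_mul mulrC. Qed.

Lemma quot_mul1 : left_id quot_one quot_mul.
Proof.
by move=> x; rewrite -[x]quot_reprK /quot_one quot_pi_mul mul1r.
Qed.

Lemma quot_mulDl : left_distributive quot_mul +%R.
Proof.
have piD u v : quot_pi (u + v) = quot_pi u + quot_pi v.
  by rewrite /quot_pi !piE.
move=> x y z; rewrite -[x]quot_reprK -[y]quot_reprK -[z]quot_reprK.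
by rewrite -piD !quot_pi_mul -piD mulrDl.
Qed.

HB.instance Definition _ := GRing.Zmodule_isComPzRing.Build quot_ring
  quot_mulA quot_mulC quot_mul1 quot_mulDl.

HB.instance Definition _ :=
  GRing.isZmodMorphism.Build R quot_ring quot_pi quot_pi_zmod_morphism.

Lemma quot_pi_monoid_morphism : monoid_morphism quot_pi.
Proof. by split=> // x y; rewrite -quot_pi_mul. Qed.

HB.instance Definition _ :=
  GRing.isMonoidMorphism.Build R quot_ring quot_pi quot_pi_monoid_morphism.

End QuotientRing.

(* The ring homomorphism A / f^-1(J) -> B / J induced by f : A -> B. *)
Section QuotientMap.
Variables (A B : comPzRingType) (f : {rmorphism A -> B}) (J : ideal B).

Definition quot_map (x : quot_ring (ideal_comap f J)) : quot_ring J :=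
  quot_pi J (f (quot_repr x)).

Lemma quot_map_pi a : quot_map (quot_pi (ideal_comap f J) a) = quot_pi J (f a).
Proof.
apply/quot_piP; rewrite -rmorphB.
change ((ideal_comap f J : set A) (quot_repr (quot_pi (ideal_comap f J) a) - a)).
by apply/quot_piP; rewrite quot_reprK.
Qed.

Lemma quot_map_zmod_morphism : zmod_morphism quot_map.
Proof.
move=> x y; rewrite -[x]quot_reprK -[y]quot_reprK -rmorphB !quot_map_pi.
by rewrite !rmorphB.
Qed.

Lemma quot_map_monoid_morphism : monoid_morphism quot_map.
Proof.
split; first by rewrite -(rmorph1 (quot_pi (ideal_comap f J))) quot_map_pi !rmorph1.
move=> x y; rewrite -[x]quot_reprK -[y]quot_reprK -rmorphM !quot_map_pi.
by rewrite !rmorphM.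
Qed.

HB.instance Definition _ := GRing.isZmodMorphism.Build
  (quot_ring (ideal_comap f J)) (quot_ring J) quot_map quot_map_zmod_morphism.
HB.instance Definition _ := GRing.isMonoidMorphism.Build
  (quot_ring (ideal_comap f J)) (quot_ring J) quot_map quot_map_monoid_morphism.

End QuotientMap.

Arguments quot_map {A B} f J x.

Section SubringType.
Variables (Q : comPzRingType) (D : subringClosed Q).

Definition subring_type := {x : Q | x \in D}.

Lemma subring_type_closed : subring_closed (fun x : Q => x \in D).
Proof.
split; first exact: rpred1.
  by move=> x y; apply: rpredB.
by move=> x y; apply: rpredM.
Qed.

HB.instance Definition _ := SubChoice.on subring_type.
HB.instance Definition _ := GRing.SubChoice_isSubComPzRing.Build
  Q (fun x => x \in D) subring_type subring_type_closed.

Definition subring_incl : {rmorphism subring_type -> Q} := \val.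

End SubringType.

Section SubringOfDomain.
Variables (K : idomainType) (D : subringClosed K).

Local Notation S := (subring_type D).

HB.instance Definition _ :=
  GRing.SubPzSemiRing_isNonZero.Build K (fun x => x \in D) S.

Definition subring_unit : {pred S} := fun x => `[< exists y : S, y * x = 1 >].

Definition subring_inv (x : S) : S :=
  if pselect (exists y : S, y * x = 1) is left h then projT1 (cid h) else x.

Lemma subring_mulVx : {in subring_unit, left_inverse 1 subring_inv *%R}.
Proof.
move=> x /asboolP h; rewrite /subring_inv; case: pselect => // h'.
by case: (cid h').
Qed.

Lemma subring_unitPl (x y : S) : y * x = 1 -> subring_unit x.
Proof. by move=> yx; apply/asboolP; exists y. Qed.

Lemma subring_inv_out : {in [predC subring_unit], subring_inv =1 id}.
Proof.
move=> x /asboolP h; rewrite /subring_inv; case: pselect => // h'.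
Qed.

HB.instance Definition _ := GRing.ComNzRing_hasMulInverse.Build S
  subring_mulVx subring_unitPl subring_inv_out.

Lemma subring_integral : GRing.integral_domain_axiom S.
Proof.
move=> x y /(congr1 val) /eqP; rewrite rmorphM rmorph0 mulf_eq0.
by rewrite -!(inj_eq val_inj) !rmorph0.
Qed.

HB.instance Definition _ := GRing.ComUnitRing_isIntegral.Build S subring_integral.

End SubringOfDomain.

Section FractionField.
Variable R : idomainType.

Local Notation K := {fraction R}.
Local Notation toK := (@FracField.tofrac R).

Definition colon (I J : set K) : set K :=
  [set x | forall y, J y -> I (x * y)].

Definition intcl_pred : {pred K} := fun x => `[< integralOver toK x >].

Lemma intcl_subring : subring_closed intcl_pred.
Proof.
split; first by apply/asboolP; apply: integral1.
  move=> x y /asboolP Ix /asboolP Iy; apply/asboolP.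
  exact (integral_sub Ix Iy).
move=> x y /asboolP Ix /asboolP Iy; apply/asboolP.
exact (integral_mul Ix Iy).
Qed.

HB.instance Definition _ := GRing.isSubringClosed.Build K intcl_pred intcl_subring.

Definition intcl : idomainType := subring_type (intcl_pred : subringClosed K).

Lemma tofrac_intcl x : toK x \in intcl_pred.
Proof. by apply/asboolP; apply: integral_id. Qed.

Definition to_intcl (x : R) : intcl := exist _ (toK x) (tofrac_intcl x).

Lemma to_intcl_zmod_morphism : zmod_morphism to_intcl.
Proof. by move=> x y; apply: val_inj; rewrite rmorphB /= rmorphB. Qed.

Lemma to_intcl_monoid_morphism : monoid_morphism to_intcl.
Proof.
split=> [|x y]; apply: val_inj; first by rewrite rmorph1 /= rmorph1.
by rewrite rmorphM /= rmorphM.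
Qed.

HB.instance Definition _ :=
  GRing.isZmodMorphism.Build R intcl to_intcl to_intcl_zmod_morphism.
HB.instance Definition _ :=
  GRing.isMonoidMorphism.Build R intcl to_intcl to_intcl_monoid_morphism.

Definition conductor : set K := colon (range toK) [set x | integralOver toK x].

(* R : R' as an ideal of R'.  Since 1 \in R', R : R' lies in R, and as an ideal
   of R it is ideal_comap to_intcl conductor_intcl; hence
   quot_map to_intcl conductor_intcl is the map R / (R : R') -> R' / (R : R'). *)
Definition conductor_intcl_set : set intcl := [set x : intcl | conductor (\val x)].

Lemma conductor0 : conductor_intcl_set 0.
Proof. by move=> y _; rewrite rmorph0 mul0r; exists 0; rewrite ?rmorph0. Qed.

Lemma conductorD x y : conductor_intcl_set x -> conductor_intcl_set y ->
  conductor_intcl_set (x + y).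
Proof.
move=> Cx Cy z Iz; rewrite rmorphD mulrDl.
have [a _ <-] := Cx z Iz; have [b _ <-] := Cy z Iz.
by exists (a + b); rewrite ?rmorphD.
Qed.

Lemma conductorM a x : conductor_intcl_set x -> conductor_intcl_set (a * x).
Proof.
move=> Cx z Iz; rewrite rmorphM mulrAC mulrC; apply: Cx.
have Ia : integralOver toK (\val a) by apply/asboolP; exact: valP a.
exact (integral_mul Ia Iz).
Qed.

Definition conductor_intcl : ideal intcl := Ideal conductor0 conductorD conductorM.

Section Localization.
Variable P : prime_ideal R.

Definition loc_pred : {pred K} := fun x =>
  `[< exists a s : R, ~ (P : set R) s /\ x = toK a / toK s >].

Lemma loc_subring : subring_closed loc_pred.
Proof.
have [P1 Pp] := prime_idealP P; rewrite /proper in P1.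
have nz s : ~ (P : set R) s -> toK s != 0.
  by move=> Ps; rewrite tofrac_eq0; apply/eqP => s0; apply: Ps; rewrite s0; exact: ideal0.
have PM s t : ~ (P : set R) s -> ~ (P : set R) t -> ~ (P : set R) (s * t).
  by move=> Ps Pt /Pp [].
split.
- by apply/asboolP; exists 1, 1; rewrite rmorph1 divr1.
- move=> _ _ /asboolP [a [s [Ps ->]]] /asboolP [b [t [Pt ->]]].
  apply/asboolP; exists (a * t - b * s), (s * t); split; first exact: PM.
  rewrite rmorphB !rmorphM -[- (toK b / _)]mulNr addf_div; [|exact: nz..].
  by rewrite mulNr.
- move=> _ _ /asboolP [a [s [Ps ->]]] /asboolP [b [t [Pt ->]]].
  apply/asboolP; exists (a * b), (s * t); split; first exact: PM.
  by rewrite !rmorphM mulf_div.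
Qed.

HB.instance Definition _ := GRing.isSubringClosed.Build K loc_pred loc_subring.

Definition localization : idomainType := subring_type (loc_pred : subringClosed K).

End Localization.

End FractionField.

Arguments intcl_pred : clear implicits.
Arguments conductor : clear implicits.

Definition noetherian (R : comPzRingType) : Prop :=
  forall I : ideal R, exists n (g : 'I_n -> R),
    I = [set x | exists c : 'I_n -> R, x = \sum_i c i * g i] :> set R.

Definition integrally_closed (R : idomainType) : Prop :=
  forall x : {fraction R}, integralOver (@FracField.tofrac R) x ->
    exists y, x = FracField.tofrac y.

(* Fields are allowed. *)
Definition dedekind (R : idomainType) : Prop :=
  [/\ noetherian R, integrally_closed R
    & forall P : prime_ideal R, (exists2 x, (P : set R) x & x != 0) ->
        is_maximal P].

Definition module_finite (A B : comPzRingType) (f : {rmorphism A -> B}) : Prop :=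
  exists n (g : 'I_n -> B), forall b, exists c : 'I_n -> A,
    b = \sum_i f (c i) * g i.

Definition unibranched (A B : comPzRingType) (f : {rmorphism A -> B}) : Prop :=
  injective f /\
  forall P : prime_ideal A, exists! Q : prime_ideal B, f @^-1` Q = P :> set A.

Definition n_absorbing (R : comPzRingType) n (I : ideal R) : Prop :=
  proper I /\
  forall a : 'I_n.+1 -> R, (I : set R) (\prod_i a i) ->
    exists i, (I : set R) (\prod_(j | j != i) a j).

Definition AF_property (R : comPzRingType) n : Prop :=
  (0 < n)%N /\
  forall I : ideal R, proper I -> exists m (J : 'I_m -> ideal R),
    (forall i, n_absorbing n (J i)) /\
    I = \big[@ideal_mul R/unit_ideal R]_(i < m) J i.

(* \bar int plays the role of the naturals extended by +oo, so that the order
   and the maximum are the ones of constructive_ereal. *)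
Definition AFdim (R : comPzRingType) : \bar int :=
  if pselect (exists n, `[< AF_property R n >]) is left h
  then (ex_minn h)%:Z%:E else +oo%E.

Definition FAF_domain (R : idomainType) : Prop := (AFdim R < +oo)%E.

(* R is identified with a subring of T along iota; naturals are positive, so
   0 < n and 0 < a i; D i is a subring of T / N_i ^ a_i. *)
Definition pullback_presentation (R T : idomainType) (iota : {rmorphism R -> T})
    n (N : 'I_n -> maximal_ideal T) (a : 'I_n -> nat)
    (D : forall i, subringClosed (quot_ring (ideal_exp (N i) (a i)))) : Prop :=
  [/\ dedekind T /\ injective iota,
      (0 < n)%N /\ injective N,
      forall i, (0 < a i)%N,
      forall i, unibranched (subring_incl (D i)) /\
                module_finite (subring_incl (D i))
    & range iota =
      (fun t i => quot_pi (ideal_exp (N i) (a i)) t) @^-1`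
        [set x | forall i, x i \in D i]].

(* Main.v *)
(** (1) => (3).  If an ideal I is a product of n-absorbing ideals, p of which lie
in the maximal ideal M, then I is contained in M^p, while every y in M has
y^(np) in I up to a factor outside M.  Together with Krull's intersection theorem
this forces R to have dimension at most 1, and, applied to the ideals C Q^A of R
with C the conductor and Q a maximal ideal of R', it shows that no two maximal
ideals of R' lie over the same maximal ideal of R.

(3) => (2).  The conductor contains the intersection of powers of the finitely
many maximal ideals N_i above it; D_i is the image of R in T / N_i^a_i, and the
Chinese remainder theorem in R identifies R with the pullback.

(2) => (1).  R is Noetherian by an Eakin-Nagata argument.  Locally at M = N_i in R,
R contains N_i^a_i, so an ideal of order e < 2 a_i contains N_i^(3 a_i) and is
3 a_i-absorbing, and an ideal of larger order is divisible by an element of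
order a_i.

The AF-property is local: in dimension one every nonzero ideal is the product of
its M-primary components, and these correspond to ideals of R_M.  This gives the
formula for AF-dim. *)

Require Import Defs.
From HB Require Import structures.
From mathcomp Require Import all_boot all_order all_algebra.
From mathcomp Require Import boolp classical_sets constructive_ereal.
From mathcomp Require Import ring zify.

Import Order.TTheory GRing.Theory Num.Theory.
Local Open Scope classical_set_scope.
Local Open Scope ring_scope.

Set Implicit Arguments.
Unset Strict Implicit.

Local Notation "x '\ini' I" := (ideal_set I x) (at level 70, no associativity).

#[local] Obligation Tactic := idtac.

(** * Ideals *)

(** Local arguments stay inside R: an ideal of R_P is represented by its contraction, a [saturated]
    ideal of R, and the ring R_P occurs only for the AF-dim formula. Likewise no valuation is built
    on T; order e at N means membership in N^e but not in N^(e+1). The constant 3a combines two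
    bounds, where a is such that R contains N^a up to a factor outside N. If A has an element x of
    order at most e, every p in R of order at least e + a lies in A, since p / x has order at least
    a; so A is n-absorbing once n >= e + a. If all elements of A have order at least e >= a + d, an
    element z of R of order d divides them with quotients of order at least a, again in R. For n >=
    2a + d one of the cases always applies. The choice d = a gives 3a; a = 0 and d = 1 treat the
    primes other than the N_i. In (3) => (2) the case R = R' stands apart: the conductor is then the
    unit ideal, while a presentation requires n > 0. The fraction fields of R and T are different
    types, so integrality equations pass from one to the other by clearing denominators. *)

Lemma one_subX (R : comPzRingType) (a s : R) k : exists b, (1 - a * s) ^+ k = 1 - b * s.
Proof.
elim: k => [|k [b e]]; first by exists 0; rewrite mul0r subr0.
by exists (a + b - a * s * b); rewrite exprS e; ring.
Qed.

Section Ideals.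
Variable R : comPzRingType.
Implicit Types (I J L M : ideal R) (P : prime_ideal R) (x y s : R).

Lemma idealN I x : x \ini I -> - x \ini I.
Proof. by move=> Ix; rewrite -mulN1r; apply: idealM. Qed.

Lemma idealB I x y : x \ini I -> y \ini I -> x - y \ini I.
Proof. by move=> Ix Iy; apply: idealD => //; apply: idealN. Qed.

Lemma idealMr I a x : x \ini I -> x * a \ini I.
Proof. by move=> Ix; rewrite mulrC; apply: idealM. Qed.

Lemma ideal_sum I n (f : 'I_n -> R) : (forall i, f i \ini I) -> \sum_i f i \ini I.
Proof. by move=> If; elim/big_ind: _ => //; [apply: ideal0|apply: idealD]. Qed.

Lemma ideal_eq I J : I `<=` J -> J `<=` I -> I = J.
Proof. by move=> IJ JI; apply: ideal_ext; apply/seteqP. Qed.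

Lemma ideal_eq1 I : 1 \ini I -> I = unit_ideal R.
Proof.
move=> I1; apply: ideal_eq => // x _.
by rewrite -[x]mulr1; apply: idealM.
Qed.

(** The ideal I + (x), with membership as a single congruence modulo I so that witnesses combine by
    [ring]. *)
Definition adjoin_set I x : set R := [set z | exists a, z - a * x \ini I].

Program Definition adjoin I x : ideal R := @Ideal R (adjoin_set I x) _ _ _.
Next Obligation. by move=> I x; exists 0; rewrite mul0r subr0; apply: ideal0. Qed.
Next Obligation.
move=> I x y z [a Ia] [b Ib]; exists (a + b).
by have := idealD Ia Ib; congr (_ \ini I); ring.
Qed.
Next Obligation.
move=> I x a y [b Ib]; exists (a * b).
by have := idealM a Ib; congr (_ \ini I); ring.
Qed.

Lemma sub_adjoin I x : I `<=` adjoin I x.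
Proof. by move=> z Iz; exists 0; rewrite mul0r subr0. Qed.

Lemma mem_adjoin I x : x \ini adjoin I x.
Proof. by exists 1; rewrite mul1r subrr; apply: ideal0. Qed.

Program Definition zero_ideal : ideal R := @Ideal R [set 0] _ _ _.
Next Obligation. by []. Qed.
Next Obligation. by move=> _ _ -> ->; rewrite addr0. Qed.
Next Obligation. by move=> a _ ->; rewrite mulr0. Qed.

Program Definition scale_ideal x I : ideal R :=
  @Ideal R [set z | exists2 y, y \ini I & z = x * y] _ _ _.
Next Obligation. by move=> x I; exists 0; rewrite ?mulr0//; apply: ideal0. Qed.
Next Obligation.
move=> x I _ _ [y Iy ->] [z Iz ->]; exists (y + z); last by rewrite mulrDr.
exact: idealD.
Qed.
Next Obligation.
move=> x I a _ [y Iy ->]; exists (a * y); last by rewrite mulrCA.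
exact: idealM.
Qed.

Program Definition quo_ideal I J : ideal R :=
  @Ideal R [set x | forall y, y \ini J -> x * y \ini I] _ _ _.
Next Obligation. by move=> I J y _; rewrite mul0r; apply: ideal0. Qed.
Next Obligation.
by move=> I J x y Ix Iy z Jz; rewrite mulrDl; apply: idealD; [apply: Ix|apply: Iy].
Qed.
Next Obligation.
by move=> I J a x Ix z Jz; rewrite -mulrA; apply: idealM; apply: Ix.
Qed.

Program Definition quo_elt I x : ideal R :=
  @Ideal R [set y | y * x \ini I] _ _ _.
Next Obligation. by move=> I x /=; rewrite mul0r; apply: ideal0. Qed.
Next Obligation. by move=> I x y z /= Iy Iz; rewrite mulrDl; apply: idealD. Qed.
Next Obligation. by move=> I x a y /= Iy; rewrite -mulrA; apply: idealM. Qed.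

(** The contraction to R of the extension of I to R_P; for P maximal and I with radical P it is I
    itself. *)
Program Definition saturation P I : ideal R :=
  @Ideal R [set x | exists2 s, ~ s \ini P & s * x \ini I] _ _ _.
Next Obligation.
move=> P I; exists 1; first by case: (prime_idealP P).
by rewrite mulr0; apply: ideal0.
Qed.
Next Obligation.
move=> P I x y [s Ps Ix] [t Pt Iy]; exists (s * t).
  by move/(proj2 (prime_idealP P)) => [].
have := idealD (idealM t Ix) (idealM s Iy); congr (_ \ini I); ring.
Qed.
Next Obligation.
move=> P I a x [s Ps Ix]; exists s => //.
by rewrite mulrCA; apply: idealM.
Qed.

Definition saturated P I := forall s x, ~ s \ini P -> s * x \ini I -> x \ini I.

Lemma primeM P x y : x * y \ini P -> x \ini P \/ y \ini P.
Proof. by case: (prime_idealP P) => _; apply. Qed.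

Lemma prime_notM P x y : ~ x \ini P -> ~ y \ini P -> ~ x * y \ini P.
Proof. by move=> Px Py /primeM[]. Qed.

Lemma prime1 P : ~ 1 \ini P.
Proof. by case: (prime_idealP P). Qed.

Lemma prime_notX P x n : ~ x \ini P -> ~ x ^+ n \ini P.
Proof.
move=> Px; elim: n => [|n IHn]; first exact: prime1.
by rewrite exprS; apply: prime_notM.
Qed.

Lemma saturation_saturated P I : saturated P (saturation P I).
Proof.
move=> s x Ps [t Pt Itsx]; exists (t * s); first exact: prime_notM.
by rewrite -mulrA.
Qed.

Lemma sub_saturation P I : I `<=` saturation P I.
Proof. by move=> x Ix; exists 1; [apply: prime1|rewrite mul1r]. Qed.

Lemma saturation_sub P I : I `<=` P -> saturation P I `<=` P.
Proof. by move=> IP x [s Ps /IP]/primeM[]. Qed.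

Lemma mem_ideal_mul I J x y : x \ini I -> y \ini J -> x * y \ini ideal_mul I J.
Proof. by move=> Ix Jy; exists 1%N, (fun=> x), (fun=> y); rewrite big_ord1. Qed.

Lemma ideal_mul_sub I J L :
  (forall x y, x \ini I -> y \ini J -> x * y \ini L) -> ideal_mul I J `<=` L.
Proof. by move=> IJL _ [n [a [b [Ia Jb ->]]]]; apply: ideal_sum => i; apply: IJL. Qed.

Lemma ideal_mul_subl I J : ideal_mul I J `<=` I.
Proof. by apply: ideal_mul_sub => x y Ix _; apply: idealMr. Qed.

Lemma ideal_mul_subr I J : ideal_mul I J `<=` J.
Proof. by apply: ideal_mul_sub => x y _ Jy; apply: idealM. Qed.

Lemma ideal_mulSS I I' J J' : I `<=` I' -> J `<=` J' ->
  ideal_mul I J `<=` ideal_mul I' J'.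
Proof.
move=> II' JJ'; apply: ideal_mul_sub => x y Ix Jy.
by apply: mem_ideal_mul; [apply: II'|apply: JJ'].
Qed.

Lemma ideal_mulC I J : ideal_mul I J = ideal_mul J I.
Proof.
by apply: ideal_eq; apply: ideal_mul_sub => x y Ix Jy; rewrite mulrC; apply: mem_ideal_mul.
Qed.

Lemma ideal_mulA I J L : ideal_mul I (ideal_mul J L) = ideal_mul (ideal_mul I J) L.
Proof.
apply: ideal_eq.
  apply: ideal_mul_sub => x y Ix.
  suff /(_ y) : ideal_mul J L `<=` quo_elt (ideal_mul (ideal_mul I J) L) x.
    by move=> h /h /=; rewrite mulrC.
  apply: ideal_mul_sub => u v Ju Lv /=; rewrite -mulrA mulrC -mulrA mulrC -mulrA mulrC.
  have := mem_ideal_mul (mem_ideal_mul Ix Ju) Lv; congr (_ \ini _); ring.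
apply: ideal_mul_sub => x y + Ly.
suff /(_ x) : ideal_mul I J `<=` quo_elt (ideal_mul I (ideal_mul J L)) y by [].
apply: ideal_mul_sub => u v Iu Jv /=; rewrite -mulrA.
by apply: mem_ideal_mul => //; apply: mem_ideal_mul.
Qed.

Lemma ideal_mulI1 I : ideal_mul I (unit_ideal R) = I.
Proof.
apply: ideal_eq; first exact: ideal_mul_subl.
by move=> x Ix; rewrite -[x]mulr1; apply: mem_ideal_mul.
Qed.

Lemma ideal_mul1I I : ideal_mul (unit_ideal R) I = I.
Proof. by rewrite ideal_mulC ideal_mulI1. Qed.

Lemma ideal_expS I n : ideal_exp I n.+1 = ideal_mul I (ideal_exp I n).
Proof. by []. Qed.

Lemma ideal_exp1 I : ideal_exp I 1 = I.
Proof. exact: ideal_mulI1. Qed.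

Lemma ideal_expD I m n : ideal_exp I (m + n) = ideal_mul (ideal_exp I m) (ideal_exp I n).
Proof.
elim: m => [|m IHm]; first by rewrite add0n ideal_mul1I.
by rewrite addSn !ideal_expS IHm ideal_mulA.
Qed.

Lemma mem_ideal_expD I m n x y :
  x \ini ideal_exp I m -> y \ini ideal_exp I n -> x * y \ini ideal_exp I (m + n).
Proof. by rewrite ideal_expD; apply: mem_ideal_mul. Qed.

Lemma ideal_exp_le I m n : (m <= n)%N -> ideal_exp I n `<=` ideal_exp I m.
Proof. by move=> /subnKC <-; rewrite ideal_expD; apply: ideal_mul_subl. Qed.

Lemma ideal_exp_prod I (T : Type) (r : seq T) (Q : pred T) (f : T -> R) :
  (forall i, f i \ini I) -> \prod_(i <- r | Q i) f i \ini ideal_exp I (count Q r).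
Proof.
move=> If; elim: r => [|i r IHr]; first by rewrite big_nil.
rewrite big_cons /=; case: (Q i) => //=.
by apply: mem_ideal_mul.
Qed.

Lemma ideal_expX I x n : x \ini I -> x ^+ n \ini ideal_exp I n.
Proof.
move=> Ix; elim: n => [|n IHn] //.
by rewrite exprS; apply: mem_ideal_mul.
Qed.

Lemma prime_exp P I n : ideal_exp I n `<=` P -> I `<=` P.
Proof.
move=> IP x Ix; have [//|Px] := pselect (x \ini P).
by case: (prime_notX (n := n) Px); apply: IP; apply: ideal_expX.
Qed.

Lemma maximal1 M x : is_maximal M -> ~ x \ini M -> exists a, 1 - a * x \ini M.
Proof.
move=> [M1 Mmax] Mx.
have [|A1] := pselect (Defs.proper (adjoin M x)).
  move=> /Mmax /(_ (@sub_adjoin M x)) e.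
  by case: Mx; rewrite -e; apply: mem_adjoin.
by have [a Ma] := contrapT A1; exists a.
Qed.

Lemma comaxX I s n : (exists a, 1 - a * s \ini I) -> exists a, 1 - a * s \ini ideal_exp I n.
Proof.
move=> [a Ia]; elim: n => [|n [b Ib]]; first by exists 0.
exists (a + b - a * s * b).
by have := mem_ideal_mul Ia Ib; congr (_ \ini _); ring.
Qed.

Lemma maximalX M s n : is_maximal M -> ~ s \ini M ->
  exists a, 1 - a * s \ini ideal_exp M n.
Proof. by move=> Mm /(maximal1 Mm); apply: comaxX. Qed.

Lemma maximal_primary M s x n : is_maximal M -> ~ s \ini M ->
  s * x \ini ideal_exp M n -> x \ini ideal_exp M n.
Proof.
move=> Mm /(maximalX n Mm)[a Ma] Msx.
have := idealD (idealM x Ma) (idealM a Msx); congr (_ \ini _); ring.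
Qed.

(** If a inverts s modulo P, some power of 1 - a s lies in I, so s is invertible modulo I as
    well. *)
Lemma radical_saturated P I : is_maximal P ->
  (forall y, y \ini P -> exists k, y ^+ k \ini I) -> saturated P I.
Proof.
move=> Pm PI s x Ps Isx; have [a Pa] := maximal1 Pm Ps.
have [k] := PI _ Pa; have [b ->] := one_subX a s k => Ib.
 have := idealD (idealM x Ib) (idealM b Isx); congr (_ \ini _); ring.
Qed.

Lemma maximal_eq M P : is_maximal M -> M `<=` P -> P = M :> ideal R.
Proof. by move=> [_ Mm] /Mm; apply; case: (prime_idealP P). Qed.

Lemma prime_ideal_eq P (Q : prime_ideal R) : P = Q :> ideal R -> P = Q.
Proof. by case: P Q => [P p] [Q q] /= e; subst; congr PrimeIdeal; apply: Prop_irrelevance. Qed.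

End Ideals.

Lemma comap_mul (A B : comPzRingType) (f : {rmorphism A -> B}) (I J : ideal A)
    (I' J' : ideal B) :
  (forall x, x \ini I -> f x \ini I') -> (forall x, x \ini J -> f x \ini J') ->
  forall x, x \ini ideal_mul I J -> f x \ini ideal_mul I' J'.
Proof.
move=> II' JJ' x; suff : ideal_mul I J `<=` ideal_comap f (ideal_mul I' J') by apply.
apply: ideal_mul_sub => u v Iu Jv; rewrite /= /preimage /= rmorphM.
by apply: mem_ideal_mul; [apply: II'|apply: JJ'].
Qed.

Lemma comap_exp (A B : comPzRingType) (f : {rmorphism A -> B}) (I : ideal A)
    (J : ideal B) n : (forall x, x \ini I -> f x \ini J) ->
  forall x, x \ini ideal_exp I n -> f x \ini ideal_exp J n.
Proof. by move=> IJ; elim: n => // n IHn; apply: comap_mul. Qed.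

(** * Noetherian rings *)

Lemma mem_gen (R : comPzRingType) (I : ideal R) n (g : 'I_n -> R) :
  I = [set x | exists c : 'I_n -> R, x = \sum_i c i * g i] :> set R ->
  forall i, g i \ini I.
Proof.
move=> -> i; exists (fun j => (j == i)%:R).
rewrite (bigD1 i) //= eqxx mul1r big1 ?addr0 // => j /negbTE ->.
by rewrite mul0r.
Qed.

Section Noetherian.
Variables (R : comPzRingType) (noethR : noetherian R).
Implicit Types (I J L M : ideal R) (P : prime_ideal R) (x y s : R).

(** Finite generation as an induction principle: a property whose solutions form an ideal need only
    be checked on the list. *)
Lemma noeth_fg I : exists l : seq R, (forall x, x \in l -> x \ini I) /\
  forall J, (forall x, x \in l -> x \ini J) -> I `<=` J.
Proof.
have [n [g Ig]] := noethR I; exists [seq g i | i : 'I_n]; split.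
  by move=> x /mapP[i _ ->]; apply: mem_gen Ig i.
move=> J gJ x; rewrite Ig => -[c ->]; apply: ideal_sum => i; apply: idealM.
by apply: gJ; apply: map_f; rewrite mem_enum.
Qed.

Lemma noeth_max (F : ideal R -> Prop) I0 : F I0 ->
  exists I, F I /\ forall J, F J -> I `<=` J -> J = I.
Proof.
move=> FI0; apply: contrapT => nomax.
have next (I : {I | F I}) : exists J : {J | F J}, sval I `<=` sval J /\ sval J <> sval I.
  apply: contrapT => noJ; apply: nomax; exists (sval I); split; first exact: svalP.
  move=> J FJ IJ; apply: contrapT => JI; apply: noJ.
  by exists (exist _ J FJ).
have [h hP] := choice next.
pose c k := sval (iter k h (exist _ I0 FI0)).
have cS m n : (m <= n)%N -> c m `<=` c n.
  move=> /subnKC <-; elim: (n - m)%N => [|k IHk]; first by rewrite addn0.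
  by rewrite addnS => x /IHk; apply: (proj1 (hP _)).
pose U : set R := [set x | exists k, x \ini c k].
have U0 : U 0 by exists 0%N; apply: ideal0.
have UD x y : U x -> U y -> U (x + y).
  move=> [m cx] [n cy]; exists (maxn m n).
  by apply: idealD; [apply: cS cx|apply: cS cy]; rewrite ?leq_maxl ?leq_maxr.
have UM a x : U x -> U (a * x) by move=> [m cx]; exists m; apply: idealM.
have [l [lU UJ]] := noeth_fg (Ideal U0 UD UM).
have [k lk] : exists k, forall x, x \in l -> x \ini c k.
  elim: l {UJ} lU => [|x l IHl] lU; first by exists 0%N.
  have [|k lk] := IHl; first by move=> y yl; apply: lU; rewrite inE yl orbT.
  have [m cx] := lU x (mem_head _ _); exists (maxn m k) => y; rewrite inE => /orP[/eqP ->|yl].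
    by apply: cS cx; rewrite leq_maxl.
  by apply: cS (lk _ yl); rewrite leq_maxr.
have [_ ck] := hP (iter k h (exist _ I0 FI0)); apply: ck; apply: ideal_eq.
  by move=> x cx; apply: (UJ _ lk); exists k.+1.
exact: (cS k k.+1).
Qed.

(** An ideal maximal among those avoiding S is prime: if x and y lie outside it, S meets both
    enlargements, and the product of the two elements found lies in the ideal when x y does. This
    stands in for localization whenever a prime has to be produced. *)
Lemma noeth_avoid (S : R -> Prop) I : S 1 ->
    (forall x y, S x -> S y -> S (x * y)) -> (forall x, x \ini I -> ~ S x) ->
  exists P, I `<=` P /\ forall x, x \ini P -> ~ S x.
Proof.
move=> S1 SM IS.
have [|Q [[IQ QS] Qmax]] := @noeth_max (fun J => I `<=` J /\ forall x, x \ini J -> ~ S x) I.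
  by split.
have meet x : ~ x \ini Q -> exists a, exists2 s, S s & s - a * x \ini Q.
  move=> Qx; apply: contrapT => nos; apply: Qx.
  rewrite -(Qmax (adjoin Q x)); [exact: mem_adjoin| |exact: sub_adjoin].
  split; first by move=> z /IQ; apply: sub_adjoin.
  by move=> s [a Qs] Ss; apply: nos; exists a, s.
have Qp : is_prime Q.
  split; first by move/QS.
  move=> x y Qxy; apply: contrapT => /not_orP[/meet[a [s Ss Qs]] /meet[b [t St Qt]]].
  apply: (QS (s * t)); last exact: SM.
  have := idealD (idealD (idealM t Qs) (idealM (a * x) Qt)) (idealM (a * b) Qxy).
  by congr (_ \ini _); ring.
by exists (PrimeIdeal Qp).
Qed.

Lemma noeth_maximal I : Defs.proper I -> exists M : maximal_ideal R, I `<=` M.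
Proof.
move=> I1; have [|M [[IM M1] Mmax]] := @noeth_max (fun J => I `<=` J /\ Defs.proper J) I.
  by split.
have Mm : is_maximal M.
  by split=> // J J1 MJ; apply: Mmax => //; split=> // x /IM /MJ.
by exists (MaximalIdeal Mm).
Qed.

(** Finitely many generators of I admit a common denominator. *)
Lemma noeth_saturation P I J : I `<=` saturation P J ->
  exists2 s, ~ s \ini P & forall x, x \ini I -> s * x \ini J.
Proof.
move=> IJ; have [l [lI Il]] := noeth_fg I.
have [s Ps sl] : exists2 s, ~ s \ini P & forall x, x \in l -> s * x \ini J.
  elim: l lI {Il} => [|x l IHl] lI; first by exists 1 => //; apply: prime1.
  have [|s Ps sl] := IHl; first by move=> y yl; apply: lI; rewrite inE yl orbT.
  have [t Pt Jt] := IJ x (lI x (mem_head _ _)).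
  exists (s * t); first exact: prime_notM.
  move=> y; rewrite inE => /orP[/eqP ->|yl]; first by rewrite -mulrA; apply: idealM.
  by rewrite mulrAC; apply: idealMr; apply: sl.
exists s => //; have : I `<=` quo_elt J s by apply: Il => x /sl /=; rewrite mulrC.
by move=> h x /h /=; rewrite mulrC.
Qed.

Lemma noeth_radical M I : (forall y, y \ini M -> exists k, y ^+ k \ini I) ->
  exists k, ideal_exp M k `<=` I.
Proof.
move=> MI; apply: contrapT => noI.
pose F J := (I `<=` J) /\ ~ exists k, ideal_exp M k `<=` J.
have [|X [[IX noX] Xmax]] := @noeth_max F I; first by split.
have [MX|] := pselect (M `<=` X); first by apply: noX; exists 1%N; rewrite ideal_exp1.
move/existsNP=> [y /not_implyP[My Xy]].
(* Let z be the last power of y outside X. Then z^2 is in X, so if X + (z) contains M^m, already X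
   contains M^(2m). *)
have Xk : exists k, `[< y ^+ k \ini X >].
  by have [k /IX Xk] := MI _ My; exists k; apply/asboolP.
have [[|[|k]] /asboolP Xyk kmin] := ex_minnP Xk.
- by apply: noX; exists 0%N; rewrite [X in _ `<=` ideal_set X](ideal_eq1 Xyk).
- by case: Xy.
have Xz : ~ y ^+ k.+1 \ini X by move/asboolP/kmin; rewrite ltnn.
apply: Xz; rewrite -(Xmax (adjoin X (y ^+ k.+1))); [exact: mem_adjoin| |exact: sub_adjoin].
split; first by move=> x /IX; apply: sub_adjoin.
move=> [m Mm]; apply: noX; exists (m + m)%N; rewrite ideal_expD.
apply: ideal_mul_sub => u v /Mm[a Xu] /Mm[b Xv].
have := idealD (idealD (idealM v Xu) (idealM (a * y ^+ k.+1) Xv))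
  (idealM (a * b * y ^+ k) Xyk).
congr (_ \ini _); rewrite !exprS; ring.
Qed.

(* Krull's intersection theorem for R / P: an ideal X containing P + M w and
   maximal subject to X :&: (w) <= P + M w contains a power of M. *)
Lemma krull_intersection P M w : P `<=` M -> Defs.proper M -> ~ w \ini P ->
  exists N, forall p, p \ini P -> ~ w - p \ini ideal_exp M N.
Proof.
move=> PM M1 Pw; apply: contrapT => noN.
pose Y' t := exists2 m, m \ini M & t - m * w \ini P.
have Y'D x y : Y' x -> Y' y -> Y' (x + y).
  move=> [a Ma Pa] [b Mb Pb]; exists (a + b); first exact: idealD.
  by have := idealD Pa Pb; congr (_ \ini _); ring.
have Y'M a x : Y' x -> Y' (a * x).
  move=> [b Mb Pb]; exists (a * b); first exact: idealM.
  by have := idealM a Pb; congr (_ \ini _); ring.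
have Y'P x : x \ini P -> Y' x by exists 0; [apply: ideal0|rewrite mul0r subr0].
pose YI := Ideal (Y'P _ (ideal0 P)) Y'D Y'M.
pose F (X : ideal R) := YI `<=` X /\ forall t, t * w \ini X -> Y' (t * w).
have [|X [[YX FX] Xmax]] := @noeth_max F YI; first by split.
have [k MX] : exists k, ideal_exp M k `<=` X.
  apply: noeth_radical => y My.
  (* The ideals X : y^j become stationary. From that j on, X + (y^j) has no more multiples of w than
     X, since y t w is in M w and hence in X; maximality of X then gives y^j in X. *)
  have [J [[j ->] Jmax]] := @noeth_max (fun J => exists j, J = quo_elt X (y ^+ j))
    (quo_elt X (y ^+ 0)) (ex_intro _ 0%N erefl).
  have Xy z : z * y ^+ j.+1 \ini X -> z * y ^+ j \ini X.
    move=> Xz; suff : z \ini quo_elt X (y ^+ j) by [].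
    rewrite -(Jmax (quo_elt X (y ^+ j.+1))) //; first by exists j.+1.
    by move=> u /= Xu; rewrite exprS mulrCA; apply: idealM.
  exists j; rewrite -(Xmax (adjoin X (y ^+ j))); [exact: mem_adjoin| |exact: sub_adjoin].
  split; first by move=> z /YX; apply: sub_adjoin.
  move=> t [r Xr]; apply: (FX).
  have : r * y ^+ j \ini X.
    apply: Xy; have /YX Xyt : Y' (y * (t * w)).
      exists (y * t); first exact: idealMr.
      by rewrite mulrA subrr; apply: ideal0.
    by have := idealB Xyt (idealM y Xr); congr (_ \ini _); rewrite exprS; ring.
  by move=> /(idealD Xr); rewrite subrK.
apply: noN; exists k => p Pp /MX Xwp.
have Xw : w \ini X by rewrite -[w](subrK p); apply: idealD => //; apply/YX/Y'P.
have := FX 1; rewrite mul1r => /(_ Xw)[m Mm Pmw].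
have : (1 - m) * w \ini P by rewrite mulrBl mul1r.
move=> /primeM[/PM M1m|//]; apply: M1; rewrite /Defs.proper.
by rewrite -[1](subrK m); apply: idealD.
Qed.

End Noetherian.

(** * Dimension at most one *)

Definition dim_le1 (R : comPzRingType) :=
  forall P : prime_ideal R, (exists2 x, x \ini P & x != 0) -> is_maximal P.

(** This says that y is nilpotent in R_P / I R_P. Otherwise a prime Q containing I avoids all s y^k;
    it is nonzero, hence maximal, and lies in P without containing y. *)
Lemma dim1_radical (R : comPzRingType) (P : prime_ideal R) (I : ideal R) x0 y :
  noetherian R -> dim_le1 R -> x0 \ini I -> x0 != 0 -> y \ini P ->
  exists s k, ~ s \ini P /\ s * y ^+ k \ini I.
Proof.
move=> nR dR Ix0 x0N0 Py; apply: contrapT => nosk.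
pose S x := exists s k, ~ s \ini P /\ x = s * y ^+ k.
have [| | |Q [IQ QS]] := @noeth_avoid _ nR S I.
- by exists 1, 0%N; rewrite mulr1; split=> //; apply: prime1.
- move=> _ _ [s [k [Ps ->]]] [t [l [Pt ->]]]; exists (s * t), (k + l)%N.
  by split; [apply: prime_notM|rewrite exprD mulrACA].
- by move=> x Ix [s [k [Ps e]]]; apply: nosk; exists s, k; rewrite -e.
have Qm : is_maximal Q by apply: dR; exists x0 => //; apply: IQ.
have QP : Q `<=` P.
  move=> x Qx; apply: contrapT => Px; apply: (QS x) => //.
  by exists x, 0%N; rewrite mulr1.
have Qy : ~ y \ini Q.
  move=> Qy; apply: (QS y) => //; exists 1, 1%N; rewrite mul1r.
  by split=> //; apply: prime1.
by apply: Qy; rewrite -(maximal_eq Qm QP).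
Qed.

(** The N-component of I contains a power of N, and a single s outside N clears the denominators. *)
Lemma primary_power (T : comPzRingType) (N : prime_ideal T) (I : ideal T) b :
  noetherian T -> dim_le1 T -> b \ini I -> b != 0 ->
  exists s a, ~ s \ini N /\ forall x, x \ini ideal_exp N a -> s * x \ini I.
Proof.
move=> nT dT Ib b0.
have [a /(noeth_saturation nT)[s Ns sP]] : exists a, ideal_exp N a `<=` saturation N I.
  apply: noeth_radical => // y Ny.
  by have [s [k [Ns Isy]]] := dim1_radical nT dT Ib b0 Ny; exists k, s.
by exists s, a.
Qed.

Lemma krull0 (T : idomainType) (M : ideal T) w : noetherian T ->
  Defs.proper M -> w != 0 -> exists N, ~ w \ini ideal_exp M N.
Proof.
move=> nT M1 w0.
have z : is_prime (zero_ideal T).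
  split; first by move/eqP; rewrite oner_eq0.
  by move=> x y /eqP; rewrite mulf_eq0 => /orP[]/eqP; [left|right].
have [|//||N wN] := @krull_intersection T nT (PrimeIdeal z) M w.
- by move=> _ /= ->; apply: ideal0.
- by move=> /= /eqP; rewrite (negbTE w0).
by exists N; have := wN 0 erefl; rewrite subr0.
Qed.

(** * Integral extensions *)

Lemma maximal_intro (R : comPzRingType) (I : ideal R) : Defs.proper I ->
  (forall x, ~ x \ini I -> exists a, 1 - a * x \ini I) -> is_maximal I.
Proof.
move=> I1 inv; split=> // J J1 IJ; apply: ideal_eq => // x Jx.
apply: contrapT => /inv[a /IJ J1ax]; apply: J1; rewrite /Defs.proper.
by rewrite -[1](subrK (a * x)); apply: idealD => //; apply: idealM.
Qed.

(** The characteristic polynomial is the monic equation; it is that of the transpose because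
    eigenvectors are rows. *)
Lemma integral_eigen (A : comNzRingType) (K : fieldType) (f : {rmorphism A -> K})
    n (g : 'I_n -> K) (m : 'M[A]_n) z i0 :
  g i0 != 0 -> (forall i, z * g i = \sum_j f (m i j) * g j) -> integralOver f z.
Proof.
move=> gi0 zg; exists (char_poly m^T); first exact: char_poly_monic.
rewrite map_char_poly -eigenvalue_root_char; apply/eigenvalueP.
exists (\row_i g i).
  apply/rowP => i; rewrite !mxE zg; apply: eq_bigr => j _.
  by rewrite !mxE mulrC.
by apply: contraNneq gi0 => /rowP/(_ i0); rewrite !mxE => ->.
Qed.

Section IntegralMaximal.
Variables (A B : comNzRingType) (f : {rmorphism A -> B}).
Hypothesis intf : forall t, integralOver f t.

Lemma integral_comap_maximal (Q : ideal B) : is_maximal Q ->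
  is_maximal (ideal_comap f Q).
Proof.
move=> Qm; apply: maximal_intro; first by rewrite /Defs.proper /= /preimage /= rmorph1; case: Qm.
move=> r /(maximal1 Qm)[t Qt]; have [p pm pt] := intf t.
(* Modulo Q the element t is inverse to f r, so (f r)^n turns a polynomial in t of degree less than
   n into a multiple of r. Applied to the equation of t without its leading term, this inverts r in
   A. *)
have low (q : {poly A}) n : (size q <= n)%N ->
    exists c, f r ^+ n * (map_poly f q).[t] - f (c * r) \ini Q.
  elim/poly_ind: q n => [|q c IHq] n.
    by exists 0; rewrite rmorph0 horner0 mulr0 mul0r rmorph0 subr0; apply: ideal0.
  rewrite size_MXaddC; case: ifP => [/andP[/eqP -> /eqP ->] _|_].
    exists 0; rewrite mul0r add0r rmorph0 horner0 mulr0 mul0r rmorph0 subr0.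
    exact: ideal0.
  case: n => // n /IHq[d Qd]; exists (d + c * r ^+ n).
  rewrite rmorphD rmorphM /= map_polyX map_polyC !hornerE /=.
  rewrite !(rmorphM, rmorphD, rmorphXn) /= in Qd *.
  have := idealB Qd (idealM (f r ^+ n * (map_poly f q).[t]) Qt).
  by congr (_ \ini _); rewrite exprS; ring.
pose d := (size p).-1; pose q := p - 'X^d.
have [|c Qc] := low q d.
  apply/leq_sizeP => j; rewrite coefB coefXn leq_eqVlt => /orP[/eqP <-|dj].
    by rewrite eqxx -/(lead_coef p) (monicP pm) subrr.
  rewrite (gtn_eqF dj) subr0 nth_default //.
  by move: dj; rewrite /d; case: (size p).
have Qtd : f r ^+ d * t ^+ d - 1 \ini Q.
  rewrite -exprMn; elim: d {q Qc} => [|d IHd]; first by rewrite expr0 subrr; apply: ideal0.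
  have := idealB IHd (idealM ((f r * t) ^+ d) Qt).
  by congr (_ \ini _); rewrite exprS; ring.
exists (- c); rewrite /= /preimage /= mulNr opprK rmorphD rmorph1.
move: Qc; rewrite /q rmorphB hornerD hornerN (rootP pt) /= map_polyXn hornerXn.
move=> Qc; have := idealN (idealD Qc Qtd); congr (_ \ini _).
by rewrite mulrBr mulr0; ring.
Qed.

Lemma integral_maximal (Q : prime_ideal B) : is_maximal (ideal_comap f Q) ->
  is_maximal Q.
Proof.
move=> Pm; apply: maximal_intro; first exact: prime1.
move=> t Qt; have [p pm pt] := intf t.
(* As long as the constant coefficient lies in Q, a factor t is cancelled, Q being prime and t
   outside it. The first constant coefficient outside Q is invertible modulo the contraction, and it
   is a multiple of t modulo Q. *)
have step (q : {poly A}) i : ~ f q`_i \ini Q -> (map_poly f q).[t] \ini Q ->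
    exists u, 1 - u * t \ini Q.
  elim/poly_ind: q i => [|q c IHq] i.
    by rewrite coef0 rmorph0 => Q0; case: Q0; apply: ideal0.
  rewrite rmorphD rmorphM /= map_polyX map_polyC !hornerE /= => Qi Qq.
  have [Qc|Qc] := pselect (f c \ini Q).
    have : (map_poly f q).[t] * t \ini Q.
      by have := idealB Qq Qc; rewrite addrK.
    move=> /primeM[Qqt|//]; apply: (IHq i.-1) => //.
    by case: i Qi => [|i]; rewrite coefD coefMX coefC /= ?add0r // addr0.
  have [a] := maximal1 Pm Qc; rewrite /= /preimage /= rmorphB rmorph1 rmorphM => Qa.
  exists (- (f a * (map_poly f q).[t])).
  by have := idealD Qa (idealM (f a) Qq); congr (_ \ini _); ring.
apply: (step p (size p).-1); last by rewrite (rootP pt); apply: ideal0.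
by rewrite -/(lead_coef p) (monicP pm) rmorph1; apply: prime1.
Qed.

End IntegralMaximal.

Local Notation toK := (@FracField.tofrac _).

Lemma toK_eq0 (R : idomainType) (x : R) : (toK x == 0) = (x == 0).
Proof. exact: tofrac_eq0. Qed.

Lemma toK_inj (R : idomainType) : injective (@FracField.tofrac R).
Proof. by move=> x y /eqP; rewrite tofrac_eq => /eqP. Qed.

Lemma fracE (R : idomainType) (x : {fraction R}) :
  exists a b, b != 0 /\ x = toK a / toK b.
Proof.
elim/quotW: x => y; exists (\n_y), (\d_y); split; first exact: denom_ratioP.
have dy0 : toK \d_y != 0 by rewrite toK_eq0 denom_ratioP.
apply: (canRL (mulfK dy0)); unlock FracField.tofrac.
rewrite -[LHS]FracField.pi_mul; apply/eqmodP => /=.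
by rewrite /FracField.mulf FracField.equivfE !numden_Ratio ?mulf_neq0 ?denom_ratioP ?oner_neq0 // !mulr1 mulrC.
Qed.

Lemma module_finite_integral (A : comNzRingType) (B : idomainType)
    (f : {rmorphism A -> B}) : module_finite f -> forall t, integralOver f t.
Proof.
move=> [n [g gP]] t; have [m mP] := choice (fun i => gP (t * g i)).
have [i0 gi0] : exists i, g i != 0.
  apply: contrapT => g0; have [c] := gP 1.
  rewrite big1 => [/eqP|i _]; first by rewrite oner_eq0.
  have [->|gi] := eqVneq (g i) 0; first by rewrite mulr0.
  by case: g0; exists i.
have [|i|p pm] := @integral_eigen A {fraction B} (toK \o f) n (fun i => toK (g i))
    (\matrix_(i, j) m i j) (toK t) i0.
- by rewrite toK_eq0.
- rewrite -rmorphM mP rmorph_sum; apply: eq_bigr => j _.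
  by rewrite mxE rmorphM.
rewrite map_poly_comp /= /root horner_map toK_eq0 => pt.
by exists p.
Qed.

(* If s N^k <= (b) with k minimal, some d in s N^(k-1) is not in (b), and d / b
   cannot map N into N since it would then be integral over T. *)
Lemma uniformizer (T : idomainType) (N : prime_ideal T) b :
  dedekind T -> b \ini N -> b != 0 ->
  exists u w, [/\ u \ini N, ~ w \ini N & forall p, p \ini N -> exists q, w * p = q * u].
Proof.
move=> [nT icT dT] Nb b0; pose I := scale_ideal b (unit_ideal T).
have Ib : b \ini I by exists 1; rewrite ?mulr1.
have [s0 [k [Ns0 s0P]]] := primary_power N nT dT Ib b0.
pose Q k := `[< exists2 s, ~ s \ini N & forall x, x \ini ideal_exp N k -> s * x \ini I >].
have exQ : exists k, Q k by exists k; apply/asboolP; exists s0.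
have {k s0 Ns0 s0P} [[|k] /asboolP [s Ns sP] kmin] := ex_minnP exQ.
  by case: Ns; have [y _ ] := sP 1 Logic.I; rewrite mulr1 => ->; apply: idealMr.
have [v Nv Isv] : exists2 v, v \ini ideal_exp N k & ~ s * v \ini I.
  apply: contrapT => nov; have : Q k; last by move/kmin; rewrite ltnn.
  apply/asboolP; exists s => // x Nx; apply: contrapT => Isx; apply: nov.
  by exists x.
have dP p : p \ini N -> exists q, s * v * p = b * q.
  move=> Np; have [q _ e] := sP _ (mem_ideal_mul Np Nv); exists q.
  by rewrite -e; ring.
(* Put d = s v, so that d N is contained in (b). If w = d u / b is outside N, then w p = (d p / b) u
   for every p in N: locally u generates N. *)
have [u [Nu uP]] : exists u, u \ini N /\ forall q, s * v * u = b * q -> ~ q \ini N.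
  apply: contrapT => nou; have [n [g gP]] := nT N.
  have Ng := mem_gen gP.
  have /choice[m mP] i : exists c : 'I_n -> T, s * v * g i = b * \sum_j c j * g j.
    apply: contrapT => noc; apply: nou; exists (g i); split=> // q e.
    by rewrite gP => -[c ec]; apply: noc; exists c; rewrite -ec.
  have [i0 gi0] : exists i, g i != 0.
    apply: contrapT => g0; move: Nb; rewrite gP => -[c].
    rewrite big1 => [/eqP|i _]; first by rewrite (negbTE b0).
    have [->|gi] := eqVneq (g i) 0; first by rewrite mulr0.
    by case: g0; exists i.
  have Kb0 : toK b != 0 by rewrite toK_eq0.
  have [|y] := icT (toK (s * v) / toK b).
    apply: (@integral_eigen T {fraction T} toK n (fun i => toK (g i))
      (\matrix_(i, j) m i j) _ i0); first by rewrite toK_eq0.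
    move=> i; apply: (mulfI Kb0); rewrite mulrA mulrCA mulfV // mulr1 -rmorphM mP.
    rewrite rmorphM rmorph_sum; congr (_ * _); apply: eq_bigr => j _.
    by rewrite mxE rmorphM.
  move=> /(canRL (divfK Kb0)) /eqP; rewrite -rmorphM tofrac_eq => /eqP e.
  by apply: Isv; exists y; rewrite // e mulrC.
have [w e] := dP u Nu; exists u, w; split=> //; first exact: uP.
move=> p Np; have [q e'] := dP p Np; exists q; apply: (mulfI b0).
by rewrite mulrA -e [RHS]mulrA -e' -!mulrA [p * u]mulrC.
Qed.

(** * Descent of the Noetherian property *)

Definition submodule (R T : comPzRingType) (f : {rmorphism R -> T}) (S : set T) :=
  [/\ S 0, forall x y, S x -> S y -> S (x + y) & forall a x, S x -> S (f a * x)].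

(** Finiteness as an induction principle over submodules; generating lists can then be concatenated
    without handling coefficients. *)
Lemma module_finite_gens (R T : comPzRingType) (f : {rmorphism R -> T}) :
  module_finite f <-> exists l : seq T,
    forall S, submodule f S -> (forall x, x \in l -> S x) -> setT `<=` S.
Proof.
split=> [[n [g gP]]|[l lP]].
  exists [seq g i | i : 'I_n] => S [S0 SD SM] gS x _.
  have [c ->] := gP x; elim/big_ind: _ => // i _; apply: SM; apply: gS.
  by apply: map_f; rewrite mem_enum.
exists (size l), (fun i => l`_i) => b.
apply: (lP [set x | exists c : 'I_(size l) -> R, x = \sum_i f (c i) * l`_i]) => //.
  split.
  - by exists (fun=> 0); rewrite big1 // => i _; rewrite rmorph0 mul0r.
  - move=> _ _ [c ->] [d ->]; exists (fun i => c i + d i).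
    by rewrite -big_split; apply: eq_bigr => i _; rewrite rmorphD mulrDl.
  - move=> a _ [c ->]; exists (fun i => a * c i).
    by rewrite mulr_sumr; apply: eq_bigr => i _; rewrite rmorphM mulrA.
move=> y /(nthP 0)[i il <-]; pose j := Ordinal il.
exists (fun k => (k == j)%:R); rewrite (bigD1 j) //= eqxx rmorph1 mul1r.
by rewrite big1 ?addr0 // => k /negbTE ->; rewrite rmorph0 mul0r.
Qed.

Section Descent.
Variables (R T : idomainType) (f : {rmorphism R -> T}) (C : ideal T) (c0 : T).
Hypotheses (f_inj : injective f) (finf : module_finite f).
Hypotheses (nT : noetherian T) (dT : dim_le1 T).
Hypotheses (Cc0 : c0 \ini C) (c0N0 : c0 != 0) (CR : C `<=` range f).

Local Notation submod := (submodule f).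

Let submodB S : submod S -> forall x y, S x -> S y -> S (x - y).
Proof.
move=> [_ SD SM] x y Sx Sy; apply: SD => //.
by have := SM (-1) y Sy; rewrite rmorphN rmorph1 mulN1r.
Qed.

Let ideal_submod (J : ideal T) : submod J.
Proof. by split=> *; [apply: ideal0|apply: idealD|apply: idealM]. Qed.

(* Finite generation of the image of S in T / J; it is proved for all J by
   Noetherian induction on J. *)
Let fg_mod (J : ideal T) := forall S, submod S -> exists l : seq T,
  (forall x, x \in l -> S x) /\
  forall S', submod S' -> J `<=` S' -> (forall x, x \in l -> S' x) -> S `<=` S'.

(** T / J is a finite-dimensional space over the field R / P, with P the contraction of J. The
    induction runs over generators of T: an element s0 of S whose coefficient at g is invertible
    modulo P eliminates g from all the others. *)
Let fg_mod_maximal (J : ideal T) : is_maximal J -> fg_mod J.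
Proof.
move=> Jm; have /module_finite_gens[gs gsP] := finf.
have Pm := integral_comap_maximal (module_finite_integral finf) Jm.
pose span := fix span (l : seq T) : set T :=
  if l is g :: l' then [set x | exists r, span l' (x - f r * g)] else J.
have span_submod l : submod (span l).
  elim: l => [|g l [S0 SD SM]]; first exact: ideal_submod.
  split=> [|x y [r Sr] [r' Sr']|a x [r Sr]].
  - by exists 0; rewrite rmorph0 mul0r subr0.
  - exists (r + r'); rewrite rmorphD mulrDl.
    by have := SD _ _ Sr Sr'; congr (span _ _); ring.
  - by exists (a * r); have := SM a _ Sr; congr (span _ _); rewrite rmorphM; ring.
have sub_span l : J `<=` span l.
  elim: l => // g l IHl x Jx; exists 0; rewrite rmorph0 mul0r subr0; exact: IHl.
have spanT l : (forall x, x \in l -> span l x).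
  elim: l => // g l IHl x; rewrite inE => /orP[/eqP ->|/IHl Sx].
    by exists 1; rewrite rmorph1 mul1r subrr; case: (span_submod l).
  by exists 0; rewrite rmorph0 mul0r subr0.
suff fgl l S : submod S -> S `<=` span l -> exists l' : seq T,
    (forall x, x \in l' -> S x) /\
    forall S', submod S' -> J `<=` S' -> (forall x, x \in l' -> S' x) -> S `<=` S'.
  move=> S Ssub; apply: (fgl gs) => // x _.
  exact: (gsP _ (span_submod gs) (spanT gs)).
elim: l S => [|g l IHl] S Ssub Sspan.
  by exists [::]; split=> // S' _ JS' _ x /Sspan /JS'.
have [Sl|] := pselect (S `<=` span l); first exact: IHl.
move/existsNP => [s0 /not_implyP[Ss0 ls0]].
have [r lr] := Sspan _ Ss0.
have Pr : ~ r \ini ideal_comap f J.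
  move=> Jr; apply: ls0; case: (span_submod l) => _ lD _.
  rewrite -[s0](subrK (f r * g)); apply: lD => //.
  by apply: sub_span; apply: idealMr.
have [a Pa] := maximal1 Pm Pr; rewrite /= /preimage /= in Pa.
have S2sub : submod (S `&` span l).
  case: Ssub => S0 SD SM; case: (span_submod l) => l0 lD lM.
  by split=> [|x y [Sx lx] [Sy ly]|b x [Sx lx]]; split; auto.
have [l' [l'S l'P]] := IHl (S `&` span l) S2sub (@subIsetr _ _ _).
exists (s0 :: l'); split.
  by move=> x; rewrite inE => /orP[/eqP -> //|/l'S[]].
move=> S' S'sub JS' l'S' x Sx; have [r' lr'] := Sspan _ Sx.
have [_ S'D S'M] := S'sub; have [_ SD SM] := Ssub; have [_ lD lM] := span_submod l.
rewrite -[x](subrK (f (r' * a) * s0)); apply: S'D; last first.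
  by apply: S'M; apply: l'S'; rewrite mem_head.
apply: (l'P S') => //; first by move=> y yl; apply: l'S'; rewrite inE yl orbT.
split; first by apply: submodB => //; apply: SM.
have := lD _ _ (submodB (span_submod l) lr' (lM (r' * a) _ lr))
  (sub_span l _ (idealM (f r' * g) Pa)).
by congr (span _ _); rewrite rmorphB rmorph1 !rmorphM; ring.
Qed.

(** Multiplication by x embeds T / (J : x) in T / J with cokernel T / (J + (x)). Generators of the
    image of S in the cokernel and of the part of S in the kernel suffice; [l3] lifts the latter to
    S. *)
Let fg_mod_colon (J : ideal T) x y : x * y \ini J ->
  fg_mod (adjoin J x) -> fg_mod (quo_elt J x) -> fg_mod J.
Proof.
move=> Jxy fgA fgB S Ssub; have [S0 SD SM] := Ssub.
have [l1 [l1S l1P]] := fgA S Ssub.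
have S2sub : submod [set t | exists2 j, j \ini J & S (t * x + j)].
  split=> [|t u [j Jj St] [k Jk Su]|a t [j Jj St]].
  - by exists 0; [apply: ideal0|rewrite mul0r addr0].
  - exists (j + k); first exact: idealD.
    by have := SD _ _ St Su; congr (S _); ring.
  - exists (f a * j); first exact: idealM.
    by have := SM a _ St; congr (S _); ring.
have [l2 [l2S l2P]] := fgB _ S2sub.
have [l3 [l3S l3P]] : exists l3 : seq T, (forall z, z \in l3 -> S z) /\
    forall t, t \in l2 -> exists2 z, z \in l3 & z - t * x \ini J.
  elim: l2 l2S {l2P} => [|t l2 IHl] l2S; first by exists [::].
  have [|l3 [l3S l3P]] := IHl; first by move=> z zl; apply: l2S; rewrite inE zl orbT.
  have [j Jj Stj] := l2S t (mem_head _ _); exists (t * x + j :: l3); split.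
    by move=> z; rewrite inE => /orP[/eqP ->|/l3S].
  move=> u; rewrite inE => /orP[/eqP ->|/l3P[z zl Jz]].
    by exists (t * x + j); rewrite ?mem_head // addrC addKr.
  by exists z; rewrite // inE zl orbT.
exists (l1 ++ l3); split.
  by move=> z; rewrite mem_cat => /orP[/l1S|/l3S].
move=> S' S'sub JS' lS' s Ss; have [S'0 S'D S'M] := S'sub.
(* The test module is (S [&] S') + J + (x), not S' + J + (x), so that the remainder a is again an
   element of S. *)
have [|||a Aa [Ssa S'sa]] :=
  l1P [set z | exists2 a, a \ini adjoin J x & S (z - a) /\ S' (z - a)] _ _ _ s Ss.
- split=> [|z u [a Aa [Sz S'z]] [b Ab [Su S'u]]|r z [a Aa [Sz S'z]]].
  + by exists 0; [apply: ideal0|rewrite subr0].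
  + exists (a + b); first exact: idealD.
    by rewrite opprD addrACA; split; [apply: SD|apply: S'D].
  + exists (f r * a); first exact: idealM.
    by rewrite -mulrBr; split; [apply: SM|apply: S'M].
- by move=> a Aa; exists a; rewrite // subrr.
- move=> z zl; exists 0; first exact: ideal0.
  by rewrite subr0; split; [apply: l1S|apply: lS'; rewrite mem_cat zl].
rewrite -[s](subrK a); apply: (S'D) => //.
have Sa : S a by rewrite -[a](subKr s); apply: submodB.
have [t Jt] := Aa.
have : S' (t * x).
  apply: (l2P [set t | S' (t * x)]).
  - split=> [|u v|b u]; rewrite /= ?mul0r ?mulrDl -?mulrA //; first exact: S'D.
    exact: S'M.
  - by move=> u /JS'.
  - move=> u /l3P[z zl Jz]; rewrite /= -[u * x](subKr z).
    by apply: submodB => //; [apply: lS'; rewrite mem_cat zl orbT|apply: JS'].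
  - by exists (a - t * x) => //; rewrite addrC subrK.
by move=> S't; rewrite -[a](subrK (t * x)); apply: (S'D) => //; apply: JS'.
Qed.

(** For s nonzero in S, the ideal s C of T lies in S because C lies in R. Modulo s C the module S is
    finitely generated, and s C itself is finite over T, hence over R. *)
Let fg_mod0 : (forall J x, x \ini J -> x != 0 -> fg_mod J) -> fg_mod (zero_ideal T).
Proof.
move=> fgJ S Ssub; have [S0 SD SM] := Ssub; have /module_finite_gens[gs gsP] := finf.
have [Sz|] := pselect (S `<=` [set 0]).
  by exists [::]; split=> // S' [S'0 _ _] _ _ x /Sz ->.
move/existsNP => [s /not_implyP[Ss /eqP s0]].
pose J := scale_ideal s C.
have JS : J `<=` S by move=> _ [y /CR[r _ <-] ->]; rewrite mulrC; apply: SM.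
have [|l [lS lP]] := fgJ J (s * c0) _ (mulf_neq0 s0 c0N0) S Ssub; first by exists c0.
have [l2 [l2J l2P]] := noeth_fg nT J.
exists (l ++ [seq g * h | g <- gs, h <- l2]); split.
  move=> x; rewrite mem_cat => /orP[/lS //|/allpairsP[[g h] /= [_ /l2J Jh ->]]].
  by apply: JS; apply: idealM.
move=> S' S'sub _ lS' x; have [S'0 S'D S'M] := S'sub.
apply: lP => //; last by move=> y yl; apply: lS'; rewrite mem_cat yl.
have I0 : [set x | forall t, S' (t * x)] 0 by move=> t; rewrite mulr0.
have ID u v : [set x | forall t, S' (t * x)] u -> [set x | forall t, S' (t * x)] v ->
    [set x | forall t, S' (t * x)] (u + v).
  by move=> Iu Iv t; rewrite mulrDr; apply: S'D; [apply: Iu|apply: Iv].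
have IM a u : [set x | forall t, S' (t * x)] u -> [set x | forall t, S' (t * x)] (a * u).
  by move=> Iu t; rewrite mulrA; apply: Iu.
suff h : J `<=` Ideal I0 ID IM by move=> u /h /(_ 1); rewrite mul1r.
apply: l2P => h hl t; apply: (gsP [set t | S' (t * h)]) => //.
- split=> [|u v|b u]; rewrite /= ?mul0r ?mulrDl -?mulrA //; first exact: S'D.
  exact: S'M.
- move=> g gl; apply: lS'; rewrite mem_cat; apply/orP; right.
  by apply/allpairsP; exists (g, h).
Qed.

(** A maximal nonzero counterexample to [fg_mod] would be prime by [fg_mod_colon], hence maximal by
    [dT], which [fg_mod_maximal] excludes. The zero ideal escapes this argument, being possibly a
    non-maximal prime, and is reached through C. *)
Lemma noetherian_descent : noetherian R.
Proof.
have fg_nz J x : x \ini J -> x != 0 -> fg_mod J.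
  move=> Jx x0; apply: contrapT => nfg.
  have [|M [[JM nfgM] Mmax]] := noeth_max nT (F := fun M => J `<=` M /\ ~ fg_mod M) (I0 := J).
    by split.
  have [M1|M1] := pselect (Defs.proper M); last first.
    apply: nfgM => S Ssub; exists [::]; split=> // S' _ MS' _ z _.
    by apply: MS'; rewrite -[z]mulr1; apply: idealM; apply: contrapT.
  have fgJ (I : ideal T) y : M `<=` I -> y \ini I -> ~ y \ini M -> fg_mod I.
    move=> MI Iy My; apply: contrapT => nI; apply: My; rewrite -(Mmax I) //.
    by split=> // z /JM /MI.
  have [Mp|nMp] := pselect (is_prime M).
    apply: nfgM; apply: fg_mod_maximal.
    by apply: (dT (P := PrimeIdeal Mp)); exists x => //; apply: JM.
  apply: nMp; split=> // y z Myz; apply: contrapT => /not_orP[My Mz].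
  apply: nfgM; apply: (fg_mod_colon Myz).
    by apply: (fgJ _ y) => //; [apply: sub_adjoin|apply: mem_adjoin].
  apply: (fgJ _ z) => //; last by rewrite /= mulrC.
  by move=> u Mu /=; apply: idealMr.
move=> I; have [|l [lI lP]] := fg_mod0 fg_nz (S := f @` I).
  split; first by exists 0; rewrite ?rmorph0 //; apply: ideal0.
    by move=> _ _ [x Ix <-] [y Iy <-]; exists (x + y); rewrite ?rmorphD //; apply: idealD.
  by move=> a _ [x Ix <-]; exists (a * x); rewrite ?rmorphM //; apply: idealM.
have /choice[g gP] (i : 'I_(size l)) : exists x, x \ini I /\ f x = l`_i.
  by have [x] := lI _ (mem_nth 0 (ltn_ord i)); exists x.
exists (size l), g; apply/seteqP; split=> x; last first.
  by move=> [c ->]; apply: ideal_sum => i; apply: idealM; case: (gP i).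
move=> Ix; pose S' := [set y | exists c : 'I_(size l) -> R, y = \sum_i f (c i) * f (g i)].
have [| | | |c e] := lP S' _ _ _ (f x).
- split.
  + by exists (fun=> 0); rewrite big1 // => i _; rewrite rmorph0 mul0r.
  + move=> _ _ [c ->] [d ->]; exists (fun i => c i + d i).
    by rewrite -big_split; apply: eq_bigr => i _; rewrite rmorphD mulrDl.
  + move=> a _ [c ->]; exists (fun i => a * c i).
    by rewrite mulr_sumr; apply: eq_bigr => i _; rewrite rmorphM mulrA.
- move=> _ ->; exists (fun=> 0); rewrite big1 // => i _; rewrite rmorph0 mul0r //.
- move=> y /(nthP 0)[i il <-]; pose j := Ordinal il.
  exists (fun k => (k == j)%:R); rewrite (bigD1 j) //= eqxx rmorph1 mul1r.
  rewrite big1 ?addr0; first by case: (gP j).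
  by move=> k /negbTE ->; rewrite rmorph0 mul0r.
- by exists x.
exists c; apply: f_inj; rewrite e rmorph_sum; apply: eq_bigr => i _.
by rewrite rmorphM.
Qed.

End Descent.

(** * Products of n-absorbing ideals *)

Section Absorbing.
Variable R : comPzRingType.
Implicit Types (I J M : ideal R) (P : prime_ideal R).

(** The empty product is included, so that factors which become the unit ideal after localization
    may be dropped. *)
Inductive absprod n : ideal R -> Prop :=
| AbsprodUnit : absprod n (unit_ideal R)
| AbsprodMul J I : n_absorbing n J -> absprod n I -> absprod n (ideal_mul J I).

Lemma AF_propertyE n : AF_property R n <->
  (0 < n)%N /\ forall I, Defs.proper I -> absprod n I.
Proof.
split=> -[n0 AF]; split=> // I /AF.
  move=> [m [J [Jn ->]]]; elim: m J Jn => [|m IHm] J Jn.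
    by rewrite big_ord0; apply: AbsprodUnit.
  by rewrite big_ord_recl; apply: AbsprodMul => //; apply: IHm.
elim=> [|J {}I Jn _ [m [L [Ln ->]]]].
  by exists 0%N, (fun=> unit_ideal R); split; [case|rewrite big_ord0].
exists m.+1, (fun i => oapp L J (unlift ord0 i)); split.
  by move=> i; case: unliftP => [j|] _ /=.
rewrite big_ord_recl unlift_none; congr ideal_mul.
by apply: eq_bigr => i _; rewrite liftK.
Qed.

Lemma absprod_mul n I J : absprod n I -> absprod n J -> absprod n (ideal_mul I J).
Proof.
elim=> [|L K Ln _ IHK] Jn; first by rewrite ideal_mul1I.
by rewrite -ideal_mulA; apply: AbsprodMul => //; apply: IHK.
Qed.

Lemma absprod1 n I : n_absorbing n I -> absprod n I.
Proof. by rewrite -{2}[I]ideal_mulI1 => In; apply: AbsprodMul => //; apply: AbsprodUnit. Qed.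

(** The first two of the n + 2 factors are merged into one. *)
Lemma n_absorbingS n I : n_absorbing n I -> n_absorbing n.+1 I.
Proof.
move=> [I1 In]; split=> // a.
pose b (i : 'I_n.+1) := if i == ord0 then a ord0 * a (lift ord0 ord0) else a (lift ord0 i).
have bS i : b (lift ord0 i) = a (lift ord0 (lift ord0 i)) by [].
rewrite big_ord_recl big_ord_recl mulrA => Ia.
have [|i Ii] := In b; first by rewrite big_ord_recl (eq_bigr _ (fun i _ => bS i)).
move: Ii; case: (unliftP ord0 i) => [k ->|->] Ii; last first.
  exists ord0; move: Ii; rewrite big_mkcond big_ord_recl eqxx /= mul1r => Ii.
  rewrite big_mkcond big_ord_recl eqxx /= mul1r big_ord_recl /=.
  by have := idealM (a (lift ord0 ord0)) Ii.
exists (lift ord0 (lift ord0 k)); move: Ii.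
rewrite big_mkcond big_ord_recl /= => Ii.
by rewrite big_mkcond big_ord_recl big_ord_recl /= mulrA.
Qed.

Lemma absprod_le m n I : (m <= n)%N -> absprod m I -> absprod n I.
Proof.
move=> mn; elim=> [|J {}I Jm _ IHI]; first exact: AbsprodUnit.
apply: AbsprodMul => //; rewrite -(subnKC mn).
elim: (n - m)%N => [|k IHk]; first by rewrite addn0.
by rewrite addnS; apply: n_absorbingS.
Qed.

Lemma AF_property_le m n : (m <= n)%N -> AF_property R m -> AF_property R n.
Proof.
move=> mn /AF_propertyE[m0 AF]; apply/AF_propertyE; split; first exact: leq_trans mn.
by move=> I /AF; apply: absprod_le.
Qed.

(** Take s y^(l+1) as one factor and n single copies of y as the others. Omitting any of the n + 1
    factors leaves a divisor of s y^(n+l), so the exponent drops by one. *)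
Lemma n_absorbing_exp n I s y k : n_absorbing n I ->
  s * y ^+ k \ini I -> s * y ^+ n \ini I.
Proof.
move=> [_ In]; have [kn|/ltnW/subnKC <-] := leqP k n.
  by rewrite -(subnKC kn) exprD mulrA; apply: idealMr.
elim: (k - n)%N => [|l IHl]; first by rewrite addn0.
move=> Il; apply: IHl; pose a (i : 'I_n.+1) := if i == ord0 then s * y ^+ l.+1 else y.
have [|i] := In a.
  rewrite big_ord_recl /= prodr_const card_ord /a /=.
  by move: Il; congr (_ \ini _); rewrite exprD; ring.
case: (unliftP ord0 i) => [j ->|->]; rewrite big_mkcond big_ord_recl /=.
  rewrite -big_mkcond /=.
  under eq_bigl => u do rewrite (inj_eq (@lift_inj _ ord0)).
  rewrite prodr_const cardC1 card_ord -mulrA -exprD; congr (_ \ini _).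
  by congr (_ * _ ^+ _); have := ltn_ord j; lia.
rewrite mul1r prodr_const card_ord => Iy.
by have := idealM (s * y ^+ l) Iy; congr (_ \ini _); rewrite exprD; ring.
Qed.

(** Here p counts the factors inside P. Each contributes s y^n by [n_absorbing_exp], whatever k is;
    every other factor contributes an element outside P, and t collects these elements together with
    the copies of s. *)
Lemma absprod_maximal n I P y s k : is_maximal P -> absprod n I ->
  y \ini P -> ~ s \ini P -> s * y ^+ k \ini I ->
  exists p t, [/\ ~ t \ini P, I `<=` ideal_exp P p & t * y ^+ (n * p) \ini I].
Proof.
move=> Pm In Py Ps; elim: In => [|J {}I Jn _ IHI] Isy.
  by exists 0%N, 1; split=> //; apply: prime1.
have [p [t [Pt IP It]]] := IHI (ideal_mul_subr Isy).
have Jy := n_absorbing_exp Jn (ideal_mul_subl Isy).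
have [JP|/existsNP[r /not_implyP[Jr Pr]]] := pselect (J `<=` P).
  exists p.+1, (s * t); split; first exact: prime_notM.
    exact: ideal_mulSS.
  by have := mem_ideal_mul Jy It; congr (_ \ini _); rewrite mulnS exprD; ring.
exists p, (r * t); split; first exact: prime_notM.
  by move=> x /ideal_mul_subr /IP.
by have := mem_ideal_mul Jr It; rewrite mulrA.
Qed.

End Absorbing.

(** One factor is zero, and n > 0 provides another one to omit. *)
Lemma zero_absorbing (R : idomainType) n : (0 < n)%N -> n_absorbing n (zero_ideal R).
Proof.
move=> n0; split; first by move/eqP; rewrite oner_eq0.
move=> a /= /eqP/prodf_eq0[i _ ai].
have [j ji] : exists j : 'I_n.+1, j != i.
  case: n n0 a i {ai} => // n _ _ i.
  have [->|i0] := eqVneq i ord0; first by exists ord_max.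
  by exists ord0; rewrite eq_sym.
by exists j; rewrite (bigD1 i) 1?eq_sym //= (eqP ai) mul0r.
Qed.

(** A maximal counterexample I lies in some maximal P. Let A be its P-component and B = I : A. Some
    s outside P lies in B, so B is strictly larger than I; A contains 1 - b s for some b, so A and B
    are comaximal and I = A B. *)
Lemma AF_local_global (R : idomainType) n :
  noetherian R -> dim_le1 R -> (0 < n)%N ->
  (forall P : prime_ideal R, is_maximal P -> forall A : ideal R, A `<=` P ->
     saturated P A -> (exists2 x, x \ini A & x != 0) -> absprod n A) ->
  AF_property R n.
Proof.
move=> nR dR n0 loc; apply/AF_propertyE; split=> // I0 _.
have [I0N0|I0z] := pselect (exists2 x, x \ini I0 & x != 0); last first.
  have -> : I0 = zero_ideal R; last exact/absprod1/zero_absorbing.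
  apply: ideal_eq => [x Ix|_ ->]; last exact: ideal0.
  by apply: contrapT => x0; apply: I0z; exists x => //; apply/eqP.
apply: contrapT => nI0.
have [|I [[[x0 Ix0 x0N0] nI] Imax]] := noeth_max nR
  (F := fun I => (exists2 x, x \ini I & x != 0) /\ ~ absprod n I) (I0 := I0).
  by split.
have [I1|/contrapT /ideal_eq1 I1] := pselect (Defs.proper I); last first.
  by apply: nI; rewrite I1; apply: AbsprodUnit.
have [M IM] := noeth_maximal nR I1; have Mm := maximal_idealP M.
pose P := prime_of_maximal M; pose A := saturation P I; pose B := quo_ideal I A.
have [s Ps As] : exists2 s, ~ s \ini P & forall x, x \ini A -> s * x \ini I.
  exact: noeth_saturation.
have IA : I `<=` A by apply: sub_saturation.
have IB : I `<=` B by move=> x Ix y _; apply: idealMr.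
have AB : I = ideal_mul A B.
  apply: ideal_eq; last by apply: ideal_mul_sub => a b Aa Bb; rewrite mulrC; apply: Bb.
  have [a Ma] := maximal1 Mm Ps.
  have [t [k [Pt Ik]]] := dim1_radical (P := P) nR dR Ix0 x0N0 Ma.
  have Ak : (1 - a * s) ^+ k \ini A by exists t.
  have [b Ab] : exists b, 1 - b * s \ini A.
    by move: Ak; have [b ->] := one_subX a s k; exists b.
  move=> x Ix; have := idealD (mem_ideal_mul Ab (IB _ Ix))
    (idealM b (mem_ideal_mul (IA _ Ix) (As : s \ini B))).
  by congr (_ \ini _); ring.
have An : absprod n A.
  apply: (loc P) => //; [exact: saturation_sub|exact: saturation_saturated|].
  by exists x0 => //; apply: IA.
have [Bn|nB] := pselect (absprod n B).
  by apply: nI; rewrite AB; apply: absprod_mul.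
apply: Ps; apply: IM; rewrite -(Imax B) //.
by split=> //; exists x0 => //; apply: IB.
Qed.

(** * Localization *)

Section Localize.
Variables (R : idomainType) (P : prime_ideal R).
Local Notation RP := (localization P).
Implicit Types (I J : ideal R) (X : ideal RP) (s a : R) (x : RP).

Lemma tofrac_loc s : toK s \in loc_pred P.
Proof. by apply/asboolP; exists s, 1; rewrite rmorph1 divr1; split=> //; apply: prime1. Qed.

Definition to_loc s : RP := exist _ (toK s) (tofrac_loc s).

Lemma to_loc_zmod_morphism : zmod_morphism to_loc.
Proof. by move=> x y; apply: val_inj; rewrite rmorphB /= rmorphB. Qed.

Lemma to_loc_monoid_morphism : monoid_morphism to_loc.
Proof.
split=> [|x y]; apply: val_inj; first by rewrite rmorph1 /= rmorph1.
by rewrite rmorphM /= rmorphM.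
Qed.

HB.instance Definition _ := GRing.isZmodMorphism.Build R RP to_loc to_loc_zmod_morphism.
HB.instance Definition _ := GRing.isMonoidMorphism.Build R RP to_loc to_loc_monoid_morphism.

Lemma to_locM : {morph to_loc : a b / a * b}.
Proof. exact: rmorphM. Qed.

Lemma to_loc_inj : injective to_loc.
Proof. by move=> a b /(congr1 val)/toK_inj. Qed.

Lemma prime_neq0 s : ~ s \ini P -> toK s != 0.
Proof. by move=> Ps; rewrite toK_eq0; apply/eqP => s0; apply: Ps; rewrite s0; apply: ideal0. Qed.

Lemma loc_rep x : exists s a, ~ s \ini P /\ x * to_loc s = to_loc a.
Proof.
have /asboolP [a [s [Ps e]]] := valP x; exists s, a; split=> //.
by apply: val_inj; rewrite rmorphM /= e divfK // prime_neq0.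
Qed.

Lemma loc_unit s : ~ s \ini P -> exists u, u * to_loc s = 1.
Proof.
move=> Ps; have inv : (toK s)^-1 \in loc_pred P.
  by apply/asboolP; exists 1, s; rewrite rmorph1 div1r.
exists (exist _ (toK s)^-1 inv : RP); apply: val_inj; rewrite rmorphM rmorph1 /=.
by rewrite mulVf // prime_neq0.
Qed.


Program Definition loc_ideal I : ideal RP :=
  @Ideal RP [set x | exists s a, [/\ ~ s \ini P, a \ini I & x * to_loc s = to_loc a]] _ _ _.
Next Obligation.
move=> I; exists 1, 0; rewrite mul0r rmorph0; split=> //; first exact: prime1.
exact: ideal0.
Qed.
Next Obligation.
move=> I x y [s [a [Ps Ia ex]]] [t [b [Pt Ib ey]]].
exists (s * t), (a * t + b * s); split; first exact: prime_notM.
  by apply: idealD; apply: idealMr.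
by rewrite (rmorphD to_loc) /= !to_locM -ex -ey; ring.
Qed.
Next Obligation.
move=> I y x [s [a [Ps Ia ex]]]; have [t [b [Pt ey]]] := loc_rep y.
exists (t * s), (b * a); split; first exact: prime_notM.
  exact: idealM.
by rewrite !to_locM -ex -ey; ring.
Qed.

Lemma mem_loc_ideal I a : a \ini I -> to_loc a \ini loc_ideal I.
Proof. by exists 1, a; rewrite rmorph1 mulr1; split=> //; apply: prime1. Qed.

Lemma loc_idealM I J : loc_ideal (ideal_mul I J) = ideal_mul (loc_ideal I) (loc_ideal J).
Proof.
apply: ideal_eq.
  move=> x [s [a [Ps IJa e]]]; have [u us] := loc_unit Ps.
  have -> : x = u * to_loc a by rewrite -e mulrCA us mulr1.
  by apply: idealM; apply: comap_mul IJa; apply: mem_loc_ideal.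
apply: ideal_mul_sub => x y [s [a [Ps Ia ex]]] [t [b [Pt Jb ey]]].
exists (s * t), (a * b); split; [exact: prime_notM|exact: mem_ideal_mul|].
by rewrite !to_locM -ex -ey; ring.
Qed.

Lemma loc_ideal_comap X : loc_ideal (ideal_comap to_loc X) = X.
Proof.
apply: ideal_eq => [x [s [a [Ps Xa e]]]|x Xx].
  have [u us] := loc_unit Ps.
  have -> : x = u * to_loc a by rewrite -e mulrCA us mulr1.
  exact: idealM.
have [s [a [Ps e]]] := loc_rep x; exists s, a; split=> //.
by rewrite /= /preimage /= -e; apply: idealMr.
Qed.

Lemma loc_ideal_unit I s : s \ini I -> ~ s \ini P -> loc_ideal I = unit_ideal RP.
Proof. by move=> Is Ps; apply: ideal_eq1; exists s, s; rewrite mul1r. Qed.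

Lemma n_absorbing_loc n I : I `<=` P -> n_absorbing n I -> n_absorbing n (loc_ideal I).
Proof.
move=> IP [_ In]; split.
  by move=> [s [a [Ps /IP Pa]]]; rewrite mul1r => /to_loc_inj e; apply: Ps; rewrite e.
move=> x [t [z [Pt Iz e]]].
have /choice[s] i := loc_rep (x i); move=> /choice[r rP].
(* The denominator t of the product is put into factor 0, which keeps the number of factors at n +
   1. *)
pose c (i : 'I_n.+1) := if i == ord0 then t else 1.
have prodc : \prod_i c i = t by rewrite /c -big_mkcond /= big_pred1_eq.
have prodx (Q : pred 'I_n.+1) :
    (\prod_(i | Q i) x i) * to_loc (\prod_(i | Q i) s i) = to_loc (\prod_(i | Q i) r i).
  by rewrite !rmorph_prod -big_split /=; apply: eq_bigr => i _; case: (rP i).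
have [|i Ii] := In (fun i => r i * c i).
  rewrite big_split prodc /=.
  have -> : (\prod_i r i) * t = (\prod_i s i) * z; last exact: idealM.
  by apply: to_loc_inj; rewrite !to_locM -e -prodx; ring.
exists i; exists ((\prod_(j | j != i) s j) * t), ((\prod_(j | j != i) r j) * t); split.
- apply: prime_notM => //; elim/big_ind: _ => [|u v|j _]; first exact: prime1.
    exact: prime_notM.
  by case: (rP j).
- have := idealM (c i) Ii; congr (_ \ini _); rewrite big_split /=.
  have -> : t = c i * \prod_(j | j != i) c j by rewrite -prodc (bigD1 i).
  by rewrite mulrCA.
- by rewrite !to_locM -prodx; ring.
Qed.

Lemma absprod_loc n I : absprod n I -> absprod n (loc_ideal I).
Proof.
elim=> [|J {}I Jn _ IHI].
  by rewrite (@loc_ideal_unit _ 1) //; [apply: AbsprodUnit|apply: prime1].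
rewrite loc_idealM; have [JP|/existsNP[s /not_implyP[Js Ps]]] := pselect (J `<=` P).
  by apply: AbsprodMul => //; apply: n_absorbing_loc.
by rewrite (loc_ideal_unit Js Ps) ideal_mul1I.
Qed.

Lemma AF_property_loc n : AF_property R n -> AF_property RP n.
Proof.
move=> /AF_propertyE[n0 AF]; apply/AF_propertyE; split=> // X X1.
rewrite -[X]loc_ideal_comap; apply: absprod_loc; apply: AF.
by move=> /=; rewrite /Defs.proper /= /preimage /= rmorph1.
Qed.

Lemma n_absorbing_comap n X : n_absorbing n X -> n_absorbing n (ideal_comap to_loc X).
Proof.
move=> [X1 Xn]; split; first by rewrite /Defs.proper /= /preimage /= rmorph1.
move=> a; rewrite /= /preimage /= rmorph_prod => /Xn[i Xi].
by exists i; rewrite rmorph_prod.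
Qed.

(** Contraction need not respect products. Here the product L of the contractions has radical
    containing the maximal ideal P, so it is saturated and equals the contraction of its
    extension. *)
Lemma absprod_comap n X : is_maximal P ->
  (forall y, y \ini P -> exists k, y ^+ k \ini ideal_comap to_loc X) ->
  absprod n X -> absprod n (ideal_comap to_loc X).
Proof.
move=> Pm + Xn; elim: Xn => [|J {}X Jn _ IHX] rad.
  by rewrite (@ideal_eq1 _ (ideal_comap _ _)) //; apply: AbsprodUnit.
have radJ y : y \ini P -> exists k, y ^+ k \ini ideal_comap to_loc J.
  by move=> /rad[k Xk]; exists k; apply: ideal_mul_subl Xk.
have radX y : y \ini P -> exists k, y ^+ k \ini ideal_comap to_loc X.
  by move=> /rad[k Xk]; exists k; apply: ideal_mul_subr Xk.
pose L := ideal_mul (ideal_comap to_loc J) (ideal_comap to_loc X).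
have radL y : y \ini P -> exists k, y ^+ k \ini L.
  move=> Py; have [k Jk] := radJ y Py; have [l Xl] := radX y Py.
  by exists (k + l)%N; rewrite exprD; apply: mem_ideal_mul.
suff -> : ideal_comap to_loc (ideal_mul J X) = L.
  by apply: AbsprodMul; [apply: n_absorbing_comap|apply: IHX].
apply: ideal_eq; last by move=> x; apply: comap_mul.
move=> x; rewrite /= /preimage /= => JXx.
suff : ideal_mul J X `<=` loc_ideal L.
  move=> /(_ _ JXx)[s [a [Ps La]]]; rewrite -to_locM => /to_loc_inj e.
  by apply: (radical_saturated Pm radL Ps); rewrite mulrC e.
by rewrite loc_idealM !loc_ideal_comap.
Qed.

Lemma AF_property_saturated n (A : ideal R) : is_maximal P -> A `<=` P ->
  saturated P A -> (forall y, y \ini P -> exists k, y ^+ k \ini A) ->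
  AF_property RP n -> absprod n A.
Proof.
move=> Pm AP sA rad /AF_propertyE[_ AF].
have e : ideal_comap to_loc (loc_ideal A) = A.
  apply: ideal_eq => x; last exact: mem_loc_ideal.
  rewrite /= /preimage /= => -[s [a [Ps Aa]]]; rewrite -to_locM => /to_loc_inj e.
  by apply: (sA s) => //; rewrite mulrC e.
rewrite -e; apply: absprod_comap => //; first by rewrite e.
apply: AF => -[s [a [Ps Aa]]]; rewrite mul1r => /to_loc_inj es.
by apply: Ps; rewrite es; apply: AP.
Qed.

End Localize.

(** * Ideals of a local pullback *)

Section LocalPullback.
Variables (R T : idomainType) (f : {rmorphism R -> T}) (N : prime_ideal T) (b : T).
(** [s0] is a unit at P that multiplies N^a into R, so a bounds the exponent of the conductor at N;
    d is the N-order of the element to be split off. *)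
Variables (s0 : R) (a d : nat).
Hypotheses (f_inj : injective f) (dedT : dedekind T) (Nmax : is_maximal N).
Hypotheses (Nb : b \ini N) (b0 : b != 0).
Let P := prime_comap f N.
Hypotheses (Pmax : is_maximal P) (Ps0 : ~ s0 \ini P).
Hypotheses (s0R : forall x, x \ini ideal_exp N a -> exists r, f r = f s0 * x).
Hypotheses (ad : (a <= d)%N) (d0 : (0 < d)%N).
Local Notation "N ^^ k" := (ideal_exp N k) (at level 30).

Let expN k : (0 < k)%N -> N ^^ k `<=` N.
Proof. by move=> k0 x /(ideal_exp_le k0); rewrite ideal_exp1. Qed.

Let unit_outside t : ~ t \ini N -> exists u r, f r = u * t /\ ~ r \ini P.
Proof.
(* The inverse is taken modulo N^d and not N^a: since d > 0, the element r0 lies in N even if a =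
   0. *)
move=> Nt; have [c Nc] := maximalX d Nmax Nt.
have [r0 r0E] := s0R (ideal_exp_le ad Nc); exists (f s0 * c), (s0 - r0).
split; first by rewrite rmorphB r0E; ring.
rewrite /= /preimage /= rmorphB => Nsr; apply: Ps0; rewrite /= /preimage /=.
rewrite -[f s0](subrK (f r0)); apply: idealD => //.
by rewrite r0E; apply: idealM; apply: expN Nc.
Qed.

(** Up to powers of w, x is q u^e with q outside N and p is a multiple of u^(e+k), where u is a
    local generator of N. *)
Let local_quotient e k x p : x \ini N ^^ e -> ~ x \ini N ^^ e.+1 ->
  p \ini N ^^ (e + k) -> exists t v, [/\ ~ t \ini N, v \ini N ^^ k & t * p = x * v].
Proof.
have [u [w [Nu Nw uw]]] := uniformizer dedT Nb b0.
have powE j y : y \ini N ^^ j -> exists q, w ^+ j * y = q * u ^+ j.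
  suff : N ^^ j `<=` quo_elt (scale_ideal (u ^+ j) (unit_ideal T)) (w ^+ j).
    by move=> h /h /= [q _ e']; exists q; rewrite mulrC e' mulrC.
  elim: j => [|j IHj]; first by move=> z _ /=; exists z; rewrite ?mulr1 ?mul1r.
  apply: ideal_mul_sub => y1 y2 /uw[q1 e1] /IHj /= [q2 _ e2].
  exists (q1 * q2) => //; rewrite !exprS.
  have -> : y1 * y2 * (w * w ^+ j) = (w * y1) * (y2 * w ^+ j) by ring.
  by rewrite e1 e2; ring.
move=> Nx Nx' Np; have [q qE] := powE _ _ Nx; have [r rE] := powE _ _ Np.
exists (q * w ^+ (e + k)), (w ^+ e * r * u ^+ k); split.
- apply: prime_notM; last exact: prime_notX.
  move=> Nq; apply: Nx'; apply: (maximal_primary (s := w ^+ e)) => //.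
    exact: prime_notX.
  by rewrite qE; apply: mem_ideal_mul => //; apply: ideal_expX.
- by apply: idealM; apply: ideal_expX.
- by rewrite -mulrA rE exprD; ring: qE.
Qed.

Let quotient_in_R e k x p : (a <= k)%N -> f x \ini N ^^ e -> ~ f x \ini N ^^ e.+1 ->
  f p \ini N ^^ (e + k) ->
  exists s v, [/\ ~ s \ini P, f v \ini N ^^ k & s * p = x * v].
Proof.
move=> ak Nx Nx' Np; have [t [v [Nt Nv tpE]]] := local_quotient Nx Nx' Np.
have [u [r [rE Pr]]] := unit_outside Nt.
have [v' v'E] := s0R (ideal_exp_le ak (idealM u Nv)).
exists (s0 * r), v'; split; first exact: prime_notM.
  by rewrite v'E; apply: idealM; apply: idealM.
by apply: f_inj; rewrite !rmorphM v'E rE; ring: tpE.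
Qed.

Let order y e : ~ y \ini N ^^ e.+1 ->
  exists e', [/\ (e' <= e)%N, y \ini N ^^ e' & ~ y \ini N ^^ e'.+1].
Proof.
elim: e => [|e IHe] Ny; first by exists 0%N.
have [Ny'|/IHe[e' [ee' ? ?]]] := pselect (y \ini N ^^ e.+1); first by exists e.+1.
by exists e'; split=> //; apply: leqW.
Qed.

(** The summand a makes the quotient of p by x lie in N^a, which is what brings it into R. *)
Let saturated_sup e x p (A : ideal R) : saturated P A -> x \ini A ->
  ~ f x \ini N ^^ e.+1 -> f p \ini N ^^ (e + a) -> p \ini A.
Proof.
move=> sA Ax /order[e' [ee' Nx Nx']] Np.
have [|s [v [Ps _ spE]]] := quotient_in_R (leqnn a) Nx Nx' (p := p).
  by apply: ideal_exp_le Np; rewrite leq_add2r.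
by apply: (sA s) => //; rewrite spE; apply: idealMr.
Qed.

(** A factor outside P can be omitted by saturation. If there is none, any n of the factors multiply
    into N^n, hence into N^(e+a), whose elements from R all lie in A. *)
Let saturated_absorbing e x (A : ideal R) n : (e + a <= n)%N -> A `<=` P ->
  saturated P A -> x \ini A -> ~ f x \ini N ^^ e.+1 -> n_absorbing n A.
Proof.
move=> en AP sA Ax Nx; split; first by move=> /AP; apply: prime1.
move=> g Ag; have [[i Pgi]|Pg] := pselect (exists i, ~ g i \ini P).
  by exists i; apply: (sA (g i)) => //; move: Ag; rewrite (bigD1 i).
exists ord0; apply: (saturated_sup sA Ax Nx); apply: ideal_exp_le en _ _.
rewrite rmorph_prod big_mkcond big_ord_recl eqxx /= mul1r.
have := @ideal_exp_prod _ N _ (index_enum 'I_n) predT (fun i => f (g (lift ord0 i))).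
have -> : count predT (index_enum 'I_n) = n.
  by rewrite count_predT -sum1_size big_const_ord iter_addn addn0 mul1n.
by apply=> i; apply: contrapT => Ngi; apply: Pg; exists (lift ord0 i).
Qed.

(* Multiples of z are split off as long as the N-order of A is at least d + a;
   below that bound A contains a fixed power of N. *)
Lemma saturated_absprod n (A : ideal R) x : (2 * a + d <= n)%N -> A `<=` P ->
  saturated P A -> x \ini A -> x != 0 -> absprod n A.
Proof.
have [nT _ _] := dedT; have N1 : Defs.proper N by apply: prime1.
(* If N^d were equal to N^(d+1), it would lie in every power of N, contrary to Krull's theorem for
   b^d. An element of exact order d is moved into R by [s0], which does not change its order. *)
have [z [Nz Nz']] : exists z, f z \ini N ^^ d /\ ~ f z \ini N ^^ d.+1.
  have [v [Nv Nv']] : exists v, v \ini N ^^ d /\ ~ v \ini N ^^ d.+1.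
    apply: contrapT => nov.
    have Nd k : N ^^ d `<=` N ^^ (k + d).
      elim: k => // k IHk y /IHk; rewrite addSn ideal_expD ideal_expS ideal_expD.
      rewrite ideal_mulA [ideal_mul N _]ideal_mulC -ideal_mulA.
      apply: ideal_mulSS => // t Nt.
      by apply: contrapT => Nt'; apply: nov; exists t.
    have [k Nk] := krull0 nT N1 (expf_neq0 d b0).
    by apply: Nk; apply: ideal_exp_le (Nd k _ _); [apply: leq_addr|apply: ideal_expX].
  have [z zE] := s0R (ideal_exp_le ad Nv); exists z; rewrite zE; split; first exact: idealM.
  by move=> h; apply: Nv'; apply: maximal_primary Nmax Ps0 h.
move=> dn AP sA Ax x0.
have [e Nx] : exists e, ~ f x \ini N ^^ e.+1.
  have [|e Nx] := krull0 nT N1 (w := f x); first by rewrite -(rmorph0 f) (inj_eq f_inj).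
  by exists e => /(ideal_exp_le (leqnSn e)).
elim/ltn_ind: e A x AP sA Ax Nx {x0} => e IHe A x AP sA Ax Nx.
have [en|ne] := leqP (e + a) n; first by apply: absprod1; apply: (saturated_absorbing en AP sA Ax).
(* Here e > a + d. If some y in A has order below e, it replaces x and the induction applies;
   otherwise e is the exact minimal order on A. *)
have [ANe|/existsNP[y /not_implyP[Ay Ny]]] := pselect (forall y, y \ini A -> f y \ini N ^^ e); last first.
  by apply: (IHe e.-1 _ A y) => //; [lia|rewrite prednK //; lia].
pose Z := saturation P (scale_ideal z (unit_ideal R)); pose B := quo_elt A z.
have Zz : z \ini Z by apply: sub_saturation; exists 1; rewrite ?mulr1.
have sZ : saturated P Z by apply: saturation_saturated.
have ZP : Z `<=` P.
  apply: saturation_sub => _ [r _ ->]; apply: idealMr; exact: expN Nz.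
have AB : A `<=` B by move=> y Ay /=; apply: idealMr.
have sB : saturated P B by move=> s y Ps By; apply: (sA s) => //; rewrite mulrA.
have BP : B `<=` P.
  move=> y By; apply: contrapT => Py; apply: Nz'; apply: ideal_exp_le (ANe z _); first lia.
  exact: (sA y).
have edE : e = (d + (e - d))%N by lia.
have quo y : y \ini A -> exists s v, [/\ ~ s \ini P, v \ini B & s * y = z * v].
  move=> Ay; have := ANe y Ay; rewrite edE => Ny.
  have [|s [v [Ps _ svE]]] := quotient_in_R _ Nz Nz' Ny; first by lia.
  by exists s, v; split=> //=; rewrite mulrC -svE; apply: idealM.
(* Locally A = z B; in R itself z is replaced by the P-component Z of (z). The exponents d + a and e
   + a are those from which powers of P lie in Z and in A, which makes Z B saturated. *)
have -> : A = ideal_mul Z B.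
  have sZB : saturated P (ideal_mul Z B).
    apply: radical_saturated => // y Py; exists ((d + a) + (e + a))%N.
    rewrite exprD; apply: mem_ideal_mul; [|apply: AB].
      by apply: (saturated_sup sZ Zz Nz'); rewrite rmorphXn; apply: ideal_expX.
    by apply: (saturated_sup sA Ax Nx); rewrite rmorphXn; apply: ideal_expX.
  apply: ideal_eq.
    by move=> y /quo[s [v [Ps Bv e1]]]; apply: (sZB s) => //; rewrite e1; apply: mem_ideal_mul.
  apply: ideal_mul_sub => y v [s Ps [r _ e1]] Bv; apply: (sA s) => //.
  by have := idealM r (Bv : v * z \ini A); congr (_ \ini _); ring: e1.
apply: absprod_mul.
  by apply: absprod1; apply: (saturated_absorbing _ ZP sZ Zz Nz'); lia.
(* Up to s, v is x / z, so its order is at most e - d; d > 0 makes this a descent. *)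
have [s [v [Ps Bv svE]]] := quo x Ax.
apply: (IHe (e - d)%N _ B v) => //; first lia.
move=> Nv; apply: Nx; apply: (maximal_primary (s := f s)) => //.
rewrite -rmorphM svE rmorphM.
by have := mem_ideal_expD Nz Nv; congr (_ \ini ideal_exp _ _); lia.
Qed.

End LocalPullback.

(** * Consequences of finite AF-dimension *)

(* For x in P < M, the number of factors of (x) + M^N is bounded independently of
   N by Krull's theorem, which puts a fixed power of any y in M into P + M^N. *)
Lemma AF_dim1 (R : idomainType) n : noetherian R -> AF_property R n -> dim_le1 R.
Proof.
move=> nR /AF_propertyE[_ AF] P [x Px x0].
have [M PM] := noeth_maximal nR (@prime1 _ P); have Mm := maximal_idealP M.
pose M' := prime_of_maximal M; have M1 : Defs.proper M by case: Mm.
have [MP|/existsNP[y /not_implyP[My Py]]] := pselect (M `<=` P).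
  by rewrite (maximal_eq Mm MP).
(* [m0] bounds the number p of factors beforehand, so y^(n p) divides w for every p that can occur,
   and N may be chosen from w alone. *)
have [m0 Mx] := krull0 nR M1 x0; pose w := y ^+ (n * m0).
have Pw : ~ w \ini P by apply: prime_notX.
have [N MNw] := krull_intersection nR PM M1 Pw.
pose I := adjoin (ideal_exp M N) x.
have I1 : Defs.proper I.
  move=> [a Ma]; apply: (MNw (w * a * x)); first exact: idealM.
  by have := idealM w Ma; congr (_ \ini _); ring.
have In := AF I I1.
have Iy : 1 * y ^+ N \ini I by rewrite mul1r; apply: sub_adjoin; apply: ideal_expX.
have [p [t [Mt IM It]]] := absprod_maximal (P := M') Mm In My (@prime1 _ M') Iy.
have pm : (p < m0)%N.
  rewrite ltnNge; apply/negP => mp; apply: Mx; apply: ideal_exp_le mp _ _.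
  by apply: IM; apply: mem_adjoin.
have [c Mc] : t * w \ini I.
  by rewrite /w -(subnKC (ltnW pm)) mulnDr exprD mulrA; apply: idealMr.
have [a Ma] := maximalX N Mm Mt; case: (MNw (a * c * x)); first exact: idealM.
have := idealD (idealM w Ma) (idealM a Mc); congr (_ \ini _); ring.
Qed.

(** Q is chosen to avoid the image of the complement of P. Only an inclusion of the contraction in P
    results; equality follows at each use from maximality of the contraction. *)
Lemma lying_over (R T : comPzRingType) (f : {rmorphism R -> T}) (J : ideal T)
    (P : prime_ideal R) : noetherian T -> (forall r, f r \ini J -> r \ini P) ->
  exists Q : prime_ideal T, J `<=` Q /\ forall r, f r \ini Q -> r \ini P.
Proof.
move=> nT JP; have [|_ _ [r Pr <-] [s Ps <-]||Q [JQ QS]] :=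
  @noeth_avoid _ nT (f @` [set r | ~ r \ini P]) J.
- by exists 1; [apply: prime1|rewrite rmorph1].
- by exists (r * s); [apply: prime_notM|rewrite rmorphM].
- by move=> x Jx [r Pr e]; apply: Pr; apply: JP; rewrite e.
exists Q; split=> // r Qr; apply: contrapT => Pr.
by apply: (QS _ Qr); exists r.
Qed.

(** Multiplication by c identifies I with an ideal of R; its generators are divided by c. *)
Lemma fractional_fg (R T : idomainType) (f : {rmorphism R -> T}) c (I : ideal T) :
  injective f -> noetherian R -> c != 0 -> (forall t, exists r, f r = f c * t) ->
  exists n (g : 'I_n -> T), (forall i, g i \ini I) /\
    forall x, x \ini I -> exists a : 'I_n -> R, x = \sum_i f (a i) * g i.
Proof.
move=> f_inj nR c0 cT; have fc0 : f c != 0 by rewrite -(rmorph0 f) (inj_eq f_inj).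
have [n [g gP]] := nR (ideal_comap f (scale_ideal (f c) I)).
have /choice[h hP] i : exists y, y \ini I /\ f (g i) = f c * y.
  by have [y Iy e] := mem_gen gP i; exists y.
exists n, h; split=> [i|x Ix]; first by case: (hP i).
have [r rE] := cT x.
have : r \ini ideal_comap f (scale_ideal (f c) I) by exists x.
rewrite gP => -[a e]; exists a; apply: (mulfI fc0); rewrite -rE e rmorph_sum mulr_sumr.
by apply: eq_bigr => i _; rewrite rmorphM; case: (hP i) => _ ->; rewrite mulrCA.
Qed.

(* If Q1 <> Q2 lie over the same P, the number p of factors of the ideal C Q1^A
   that lie in P satisfies C <= Q2^p, so p is bounded while A is not. *)
Lemma contraction_inj (R T : idomainType) (f : {rmorphism R -> T}) (C : ideal T) c0 n
    (Q1 Q2 : prime_ideal T) :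
  injective f -> noetherian R -> AF_property R n -> noetherian T ->
  C `<=` range f -> c0 \ini C -> c0 != 0 -> (exists2 q, q \ini Q1 & q != 0) ->
  is_maximal Q1 -> is_maximal Q2 -> (forall r, f r \ini Q1 <-> f r \ini Q2) -> Q1 = Q2.
Proof.
move=> f_inj nR AFn nT CR Cc0 c00 [q Qq q0] Q1m Q2m Q12.
have dR := AF_dim1 nR AFn; have [_ AF] := (AF_propertyE R n).1 AFn.
have f_eq0 r : f r != 0 -> r != 0 by apply: contraNneq => ->; rewrite rmorph0.
apply: contrapT => nQ12.
have [|/existsNP[e /not_implyP[Qe Q2e]]] := pselect (Q1 `<=` Q2).
  by move/(maximal_eq Q1m) => e; apply: nQ12; apply: prime_ideal_eq.
pose P := prime_comap f Q1.
have [y _ yE] : range f (c0 * q) by apply: CR; apply: idealMr.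
have y0 : y != 0 by apply: f_eq0; rewrite yE mulf_neq0.
have Py : y \ini P by rewrite /= /preimage /= yE; apply: idealM.
have Pm : is_maximal P by apply: dR; exists y.
(* g will bound p through the order of c0 at Q2. A is chosen afterwards, beyond the Q1-order of y^(n
   g). *)
have [g Qg] := krull0 nT (@prime1 _ Q2) c00.
have fyn : f y ^+ (n * g) != 0 by rewrite expf_neq0 // yE mulf_neq0.
have [A QA] := krull0 nT (@prime1 _ Q1) fyn.
pose I := ideal_comap f (ideal_mul C (ideal_exp Q1 A)).
have I1 : Defs.proper I.
  rewrite /Defs.proper /= /preimage /= rmorph1 => /ideal_mul_subr Q1A; apply: QA.
  by rewrite -[_ ^+ _]mulr1; apply: idealM.
have [r _ rE] : range f (c0 * q ^+ A) by apply: CR; apply: idealMr.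
have Ir : r \ini I.
  by rewrite /= /preimage /= rE; apply: mem_ideal_mul => //; apply: ideal_expX.
have r0 : r != 0 by apply: f_eq0; rewrite rE mulf_neq0 ?expf_neq0.
have [s [k [Ps Isy]]] := dim1_radical nR dR Ir r0 Py.
have [p [t [Pt IP It]]] := absprod_maximal Pm (AF I I1) Py Ps Isy.
(* c0 e^A lies in C Q1^A, hence in P^p and so in Q2^p. As e is invertible modulo Q2^p, c0 itself
   would lie in Q2^p. *)
have pg : (p < g)%N.
  rewrite ltnNge; apply/negP => gp; apply: Qg; apply: ideal_exp_le gp _ _.
  have [a Qa] := maximalX p Q2m (prime_notX (n := A) Q2e).
  have [r' _ r'E] : range f (c0 * e ^+ A) by apply: CR; apply: idealMr.
  have : f r' \ini ideal_exp Q2 p.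
    apply: (comap_exp (I := P)) => [x /Q12 //|]; apply: IP.
    by rewrite /= /preimage /= r'E; apply: mem_ideal_mul => //; apply: ideal_expX.
  move=> Qr'; have := idealD (idealM c0 Qa) (idealM a Qr').
  by congr (_ \ini _); rewrite r'E; ring.
apply: QA; apply: (maximal_primary (s := f t)) => //.
apply: (@ideal_mul_subr _ C); rewrite -rmorphXn -rmorphM.
suff : t * y ^+ (n * g) \ini I by [].
by rewrite -(subnKC (ltnW pg)) mulnDr exprD mulrA; apply: idealMr.
Qed.

Lemma quot_prime (R : comPzRingType) (J : ideal R) (Q : prime_ideal R) : J `<=` Q ->
  exists Q' : prime_ideal (quot_ring J), forall x, quot_pi J x \ini Q' <-> x \ini Q.
Proof.
move=> JQ; pose S : set (quot_ring J) := [set y | quot_repr y \ini Q].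
have SP x : S (quot_pi J x) <-> x \ini Q.
  have : quot_repr (quot_pi J x) - x \ini Q by apply/JQ/quot_piP; rewrite quot_reprK.
  split=> Qx; first by have := idealB Qx H; rewrite subKr.
  by rewrite /S /= -[quot_repr _](subrK x); apply: idealD.
have S0 : S 0 by rewrite -(rmorph0 (quot_pi J)); apply/SP; apply: ideal0.
have SD x y : S x -> S y -> S (x + y).
  rewrite -[x]quot_reprK -[y]quot_reprK -rmorphD => /SP Qx /SP Qy; apply/SP.
  exact: idealD.
have SM a x : S x -> S (a * x).
  rewrite -[x]quot_reprK -[a]quot_reprK -rmorphM => /SP Qx; apply/SP.
  exact: idealM.
have Sp : is_prime (Ideal S0 SD SM).
  split; first by rewrite /Defs.proper /= -(rmorph1 (quot_pi J)) => /SP/prime1.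
  move=> x y /=; rewrite -[x]quot_reprK -[y]quot_reprK -rmorphM => /SP/primeM[Qx|Qx].
    by left; apply/SP.
  by right; apply/SP.
by exists (PrimeIdeal Sp) => x; apply: SP.
Qed.

(** The sum is the homogenization of p at (a, b). Being an element of A, its vanishing carries a
    root a / b from one field over A to another. *)
Lemma horner_frac (A : comNzRingType) (F : fieldType) (g : {rmorphism A -> F})
    (p : {poly A}) a b : g b != 0 ->
  g (\sum_(i < size p) p`_i * a ^+ i * b ^+ ((size p).-1 - i)) =
    g b ^+ (size p).-1 * (map_poly g p).[g a / g b].
Proof.
move=> gb; rewrite (horner_coef_wide _ (size_poly _ _)) mulr_sumr rmorph_sum.
apply: eq_bigr => i _; rewrite coef_map !rmorphM !rmorphXn expr_div_n.
have iN : (i <= (size p).-1)%N by have := ltn_ord i; lia.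
have -> : g b ^+ (size p).-1 = g b ^+ ((size p).-1 - i) * g b ^+ i.
  by rewrite -exprD subnK.
by field; rewrite expf_neq0.
Qed.

(** * The integral closure and its conductor *)

Section IntegralClosure.
Variable R : idomainType.
Local Notation T := (intcl R).
Local Notation i := (@to_intcl R).
Local Notation K := {fraction R}.

Lemma to_intcl_inj : injective i.
Proof. by move=> a b /(congr1 val)/toK_inj. Qed.

Lemma to_intclM a b : i (a * b) = i a * i b.
Proof. exact: rmorphM. Qed.

Definition intcl_val : {rmorphism T -> K} := subring_incl (intcl_pred R : subringClosed K).

Lemma intcl_val_inj : injective intcl_val.
Proof. exact: val_inj. Qed.

Lemma intcl_val_eq0 t : (intcl_val t == 0) = (t == 0).
Proof. by rewrite -(rmorph0 intcl_val) (inj_eq intcl_val_inj). Qed.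

Lemma intcl_valP t : integralOver (@FracField.tofrac R) (intcl_val t).
Proof. by apply/asboolP; apply: valP t. Qed.

Lemma intcl_valK x : integralOver (@FracField.tofrac R) x -> exists t, intcl_val t = x.
Proof. by move=> /asboolP ix; exists (exist _ x ix). Qed.

Lemma intcl_integral (t : T) : integralOver i t.
Proof.
have [p pm pt] := intcl_valP t; exists p => //.
rewrite /root -intcl_val_eq0 -horner_map -map_poly_comp.
by rewrite (eq_map_poly (g := toK)).
Qed.

(** An element of the fraction field of T is moved into K with [horner_frac]; there it is a root of
    a monic polynomial with coefficients integral over R. *)
Lemma intcl_integrally_closed : integrally_closed T.
Proof.
move=> x [p pm px]; have [a [b [b0 xE]]] := fracE x.
have Kb0 : intcl_val b != 0 by rewrite intcl_val_eq0.
have := @horner_frac T {fraction T} toK p a b; rewrite toK_eq0 => /(_ b0).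
rewrite -xE (rootP px) mulr0 => /eqP; rewrite toK_eq0 => /eqP pab.
have := @horner_frac T K intcl_val p a b Kb0; rewrite pab rmorph0 => /esym/eqP.
rewrite mulf_eq0 expf_eq0 (negbTE Kb0) andbF orFb => pz.
have [|y yE] := @intcl_valK (intcl_val a / intcl_val b).
  apply: (integral_root_monic _ pz); first exact: (monic_map intcl_val).
  by move=> _ /(nthP 0)[j _ <-]; rewrite coef_map; apply: intcl_valP.
exists y; rewrite xE; apply: (canLR (mulfK _)); first by rewrite toK_eq0.
by rewrite -rmorphM; congr toK; apply: intcl_val_inj; rewrite rmorphM yE divfK.
Qed.

Lemma conductor_to_intcl (x : T) : x \ini conductor_intcl R -> exists r, x = i r.
Proof.
move=> Cx; have [|r _ e] := Cx 1; first exact: integral1.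
by exists r; apply: val_inj; rewrite /= e mulr1.
Qed.

Lemma conductor_fractional c : i c \ini conductor_intcl R ->
  forall t, exists r, i r = i c * t.
Proof.
move=> Cc t; have /asboolP it := valP t; have [r _ e] := Cc _ it.
by exists r; apply: val_inj; rewrite rmorphM.
Qed.

Lemma conductor_neq0 : conductor R <> [set 0] ->
  exists2 c, i c \ini conductor_intcl R & c != 0.
Proof.
move=> Cn0; apply: contrapT => noc; apply: Cn0; apply/seteqP; split=> x /=; last first.
  by move=> -> y _; rewrite mul0r; exists 0; rewrite ?rmorph0.
move=> Cx; have [|c _] := Cx 1; first exact: integral1.
rewrite mulr1 => cx; apply: contrapT => /eqP x0; apply: noc; exists c.
  by rewrite /= /conductor_intcl_set /= cx.
by apply: contraNneq x0 => c0; rewrite -cx c0 rmorph0.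
Qed.

(** A nonzero c in the conductor embeds T in R as c T, so all ideals of T, and T itself, are finite
    over R. *)
Lemma intcl_structure : noetherian R -> dim_le1 R -> conductor R <> [set 0] ->
  dedekind T /\ module_finite i.
Proof.
move=> nR dR /conductor_neq0[c Cc c0]; have cT := conductor_fractional Cc.
split; first split.
- move=> I; have [n [g [Ig gP]]] := fractional_fg I to_intcl_inj nR c0 cT.
  exists n, g; apply/seteqP; split=> [x /gP[a ->]|x [a ->]]; first by exists (fun k => i (a k)).
  by apply: ideal_sum => k; apply: idealM.
- exact: intcl_integrally_closed.
- move=> Q [x Qx x0]; apply: (integral_maximal intcl_integral).
  (* The contraction of Q is nonzero since c x comes from R. *)
  apply: (dR (prime_comap i Q)); have [r rE] := cT x; exists r.
    by rewrite /= /preimage /= rE; apply: idealM.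
  apply: contraNneq x0 => r0; apply/eqP; apply: (mulfI (x := i c)).
    by rewrite -(rmorph0 i) (inj_eq to_intcl_inj).
  by rewrite mulr0 -rE r0 rmorph0.
- have [n [g [_ gP]]] := fractional_fg (unit_ideal T) to_intcl_inj nR c0 cT.
  by exists n, g => b; apply: gP.
Qed.

Lemma AF_intcl_unibranched n : noetherian R -> AF_property R n ->
  conductor R <> [set 0] -> unibranched (quot_map i (conductor_intcl R)).
Proof.
move=> nR AFn Cn0; have dR := AF_dim1 nR AFn.
have [[nT _ dT] _] := intcl_structure nR dR Cn0.
have [c Cc c0] := conductor_neq0 Cn0; set C := conductor_intcl R in Cc *.
have ic0 : i c != 0 by rewrite -(rmorph0 i) (inj_eq to_intcl_inj).
have CQ (Q : prime_ideal T) : C `<=` Q -> is_maximal Q.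
  by move=> CQ; apply: dT; exists (i c) => //; apply: CQ.
split.
  move=> x y; rewrite -[x]quot_reprK -[y]quot_reprK /= !quot_map_pi.
  by move=> /quot_piP; rewrite -rmorphB => Cxy; apply/quot_piP.
move=> P; pose P0 := prime_comap (quot_pi (ideal_comap i C)) P.
have P0E r : quot_pi (ideal_comap i C) r \ini P <-> r \ini P0 by [].
have [|Q [CsQ QP]] := @lying_over R T i C P0 nT.
  move=> r Cr; suff : quot_pi (ideal_comap i C) r \ini P by [].
  have -> : quot_pi (ideal_comap i C) r = 0.
    by rewrite -(rmorph0 (quot_pi (ideal_comap i C))); apply/quot_piP; rewrite subr0.
  exact: ideal0.
have Qm := CQ Q CsQ.
have QP0 r : i r \ini Q <-> r \ini P0.
  have Pm := integral_comap_maximal intcl_integral Qm.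
  by rewrite (maximal_eq Pm QP).
have [Q' Q'E] := quot_prime CsQ.
exists Q'; split.
  apply/seteqP; split=> x; rewrite -[x]quot_reprK /preimage /= quot_map_pi.
    by move=> /Q'E/QP0.
  by move=> /P0E/QP0/Q'E.
move=> Q2' Q2P; pose Q2 := prime_comap (quot_pi C) Q2'.
have CQ2 : C `<=` Q2.
  move=> x Cx; suff : quot_pi C x \ini Q2' by [].
  have -> : quot_pi C x = 0.
    by rewrite -(rmorph0 (quot_pi C)); apply/quot_piP; rewrite subr0.
  exact: ideal0.
have Q2E : Q = Q2.
  apply: (contraction_inj (f := i) (C := C) to_intcl_inj nR AFn nT _ Cc ic0 _ Qm (CQ _ CQ2)).
  - by move=> x /conductor_to_intcl[r ->]; exists r.
  - by exists (i c) => //; apply: CsQ.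
  - move=> r; rewrite QP0 -P0E -Q2P.
    by rewrite /preimage /= quot_map_pi.
apply: prime_ideal_eq; apply: ideal_eq => x; rewrite -[x]quot_reprK.
  by move/Q'E; rewrite Q2E.
by move=> Q2x; apply/Q'E; rewrite Q2E.
Qed.

Lemma module_finite_quot (A B : comPzRingType) (f : {rmorphism A -> B}) (J : ideal B) :
  module_finite f -> module_finite (quot_map f J).
Proof.
move=> [n [g gP]]; exists n, (fun k => quot_pi J (g k)) => b.
have [c e] := gP (quot_repr b); exists (fun k => quot_pi _ (c k)).
rewrite -[b]quot_reprK e rmorph_sum; apply: eq_bigr => k _.
by rewrite /= quot_map_pi -rmorphM.
Qed.

End IntegralClosure.
Arguments intcl_val {R}.

(** * Pullback presentations *)

Lemma maximal_ideal_eq (R : comPzRingType) (M M' : maximal_ideal R) : M `<=` M' -> M = M'.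
Proof.
case: M M' => [M Mm] [M' M'm] /= MM'; have e : M' = M by case: Mm => _; apply => //; case: M'm.
by subst; congr MaximalIdeal; apply: Prop_irrelevance.
Qed.

(** A maximal counterexample would be prime, hence maximal and contained in itself only.
    [{classic _}] supplies the equality test for list membership. *)
Lemma finite_maximal (T : comPzRingType) (I : ideal T) b :
  noetherian T -> dim_le1 T -> b \ini I -> b != 0 ->
  exists l : seq {classic maximal_ideal T}, forall M : maximal_ideal T, I `<=` M ->
    (M : {classic maximal_ideal T}) \in l.
Proof.
move=> nT dT; pose fin (J : ideal T) := exists l : seq {classic maximal_ideal T},
  forall M : maximal_ideal T, J `<=` M -> (M : {classic maximal_ideal T}) \in l.
move=> Ib b0; apply: contrapT => nI.
have [|J [[Jb nJ] Jmax]] := noeth_max nT (F := fun J => b \ini J /\ ~ fin J) (I0 := I).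
  by split.
have bigger x : ~ x \ini J -> fin (adjoin J x).
  move=> Jx; apply: contrapT => nA; apply: Jx; rewrite -(Jmax (adjoin J x)).
  - exact: mem_adjoin.
  - by split=> //; apply: sub_adjoin.
  - exact: sub_adjoin.
have [J1|J1] := pselect (Defs.proper J); last first.
  apply: nJ; exists [::] => M JM; case: J1 => J1; case: (maximal_idealP M) => M1 _.
  by apply: M1; apply: JM.
have [Jp|nJp] := pselect (is_prime J).
  have Jm : is_maximal J by apply: (dT (PrimeIdeal Jp)); exists b.
  apply: nJ; exists [:: MaximalIdeal Jm : {classic maximal_ideal T}] => M JM.
  by rewrite inE; apply/eqP/esym/maximal_ideal_eq.
apply: nJp; split=> // x y Jxy; apply: contrapT => /not_orP[/bigger[l1 l1P] /bigger[l2 l2P]].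
apply: nJ; exists (l1 ++ l2) => M JM; rewrite mem_cat; apply/orP.
have AM z : z \ini M -> adjoin J z `<=` M.
  by move=> Mz u [a /JM Mu]; rewrite -[u](subrK (a * z)); apply: idealD => //; apply: idealM.
have /primeM[Mx|My] : x * y \ini prime_of_maximal M by apply: JM.
  by left; apply/l1P/AM.
by right; apply/l2P/AM.
Qed.

(** Multiply powers of elements of the M_l outside M_k, then divide by the product modulo the given
    power of M_k. *)
Lemma crt_idempotent (R : comPzRingType) n (M : 'I_n -> ideal R) (a : 'I_n -> nat) k :
  (forall k, is_maximal (M k)) -> (forall k l, k != l -> ~ M l `<=` M k) ->
  exists e, 1 - e \ini ideal_exp (M k) (a k) /\
    forall l, l != k -> e \ini ideal_exp (M l) (a l).
Proof.
move=> Mm Md; pose P := prime_of_maximal (MaximalIdeal (Mm k)).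
have /choice[g gP] l : exists e, l != k -> e \ini M l /\ ~ e \ini P.
  have [->|lk] := eqVneq l k; first by exists 0.
  have kl : k != l by rewrite eq_sym.
  by have /existsNP[e /not_implyP[Me Me']] := Md _ _ kl; exists e.
pose p := \prod_(l | l != k) g l ^+ a l.
have [|c Pc] := maximalX (s := p) (a k) (Mm k).
  suff : ~ p \ini P by [].
  rewrite /p; elim/big_ind: _ => [|x y|l lk]; [exact: prime1|exact: prime_notM|].
  by apply: prime_notX; case: (gP l lk).
exists (c * p); split=> // l lk; rewrite /p (bigD1 l) //=.
by apply: idealM; apply: idealMr; apply: ideal_expX; case: (gP l lk).
Qed.

Lemma crt (R : comPzRingType) n (M : 'I_n -> ideal R) (a : 'I_n -> nat) (r : 'I_n -> R) :
  (forall k, is_maximal (M k)) -> (forall k l, k != l -> ~ M l `<=` M k) ->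
  exists x, forall k, x - r k \ini ideal_exp (M k) (a k).
Proof.
move=> Mm Md; have /choice[e eP] k := @crt_idempotent R n M a k Mm Md.
exists (\sum_l e l * r l) => k; rewrite (bigD1 k) //=.
have [ek _] := eP k.
have -> : e k * r k + \sum_(l | l != k) e l * r l - r k =
  - r k * (1 - e k) + \sum_(l | l != k) e l * r l by ring.
apply: idealD; first exact: idealM.
elim/big_ind: _ => [|x y|l lk]; [exact: ideal0|exact: idealD|].
by apply: idealMr; case: (eP l) => _; apply; rewrite eq_sym.
Qed.

Section ImageSubring.
Variables (A B : comPzRingType) (g : {rmorphism A -> B}).

Definition image_pred : {pred B} := fun y => `[< range g y >].

Lemma image_subring : subring_closed image_pred.
Proof.
split; first by apply/asboolP; exists 1; rewrite ?rmorph1.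
  move=> _ _ /asboolP[x _ <-] /asboolP[y _ <-]; apply/asboolP.
  by exists (x - y); rewrite ?rmorphB.
move=> _ _ /asboolP[x _ <-] /asboolP[y _ <-]; apply/asboolP.
by exists (x * y); rewrite ?rmorphM.
Qed.

HB.instance Definition _ := GRing.isSubringClosed.Build B image_pred image_subring.

Definition image_closed : subringClosed B := image_pred.

Lemma mem_image x : g x \in image_pred.
Proof. by apply/asboolP; exists x. Qed.

End ImageSubring.

Lemma primary_quotient_prime (T : comPzRingType) (N : maximal_ideal T) a
    (Q : prime_ideal (quot_ring (ideal_exp N a))) x :
  quot_pi (ideal_exp N a) x \ini Q <-> x \ini N.
Proof.
pose Q0 := prime_comap (quot_pi (ideal_exp N a)) Q.
have : N `<=` Q0.
  apply: (@prime_exp _ _ _ a) => y Ny; suff : quot_pi (ideal_exp N a) y \ini Q by [].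
  have -> : quot_pi (ideal_exp N a) y = 0; last exact: ideal0.
  by rewrite -(rmorph0 (quot_pi (ideal_exp N a))); apply/quot_piP; rewrite subr0.
move=> /(maximal_eq (maximal_idealP N)) e.
by have -> : (x \ini N) = (x \ini Q0) by rewrite e.
Qed.

Section ImageQuotient.
Variables (R T : idomainType) (f : {rmorphism R -> T}) (N : maximal_ideal T) (a : nat).
Local Notation B := (quot_ring (ideal_exp N a)).
Let g : {rmorphism R -> B} := quot_pi (ideal_exp N a) \o f.
Let D : subringClosed B := image_closed g.

Lemma image_module_finite : module_finite f -> module_finite (subring_incl D).
Proof.
move=> [n [h hP]]; exists n, (fun k => quot_pi _ (h k)) => b.
have [c e] := hP (quot_repr b).
exists (fun k => exist _ (g (c k)) (mem_image g (c k)) : subring_type D).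
rewrite -[LHS]quot_reprK e rmorph_sum; apply: eq_bigr => k _.
by rewrite /= /g /= -rmorphM.
Qed.

(** N is nilpotent modulo N^a, so B has a single prime. In D the elements of N are nilpotent, and
    every other one is invertible modulo N already in R, so each prime of D is the contraction of
    that prime. *)
Lemma image_unibranched : (0 < a)%N -> is_maximal (ideal_comap f N) ->
  unibranched (subring_incl D).
Proof.
move=> a0 Pm; split; first exact: val_inj.
have [NQ NQE] : exists Q : prime_ideal B, forall x, quot_pi _ x \ini Q <-> x \ini N.
  have [|Q QE] := @quot_prime T (ideal_exp N a) (prime_of_maximal N); last by exists Q.
  by move=> x /(ideal_exp_le a0); rewrite ideal_exp1.
move=> P; exists NQ; split; last first.
  move=> Q _; apply: prime_ideal_eq; apply: ideal_eq => x; rewrite -[x]quot_reprK.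
    by move=> /NQE Nx; apply/primary_quotient_prime.
  by move=> /primary_quotient_prime Nx; apply/NQE.
have sub (x : subring_type D) : val x \ini NQ -> x \ini P.
  rewrite -[val x]quot_reprK => /NQE Nx; apply: contrapT => /(prime_notX (n := a)); apply.
  have -> : x ^+ a = 0; last exact: ideal0.
  apply: val_inj; rewrite rmorphXn rmorph0 /= -[val x]quot_reprK -rmorphXn.
  rewrite -(rmorph0 (quot_pi (ideal_exp N a))); apply/quot_piP; rewrite subr0.
  exact: ideal_expX.
apply/seteqP; split=> x; rewrite /preimage /=; first exact: sub.
move=> Px; have /asboolP[r _ rE] := valP x; apply: contrapT => NQx.
have Nr : ~ r \ini ideal_comap f N.
  by move=> Nr; apply: NQx; rewrite -rE; apply/NQE.
have [c Nc] := maximal1 Pm Nr.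
pose y : subring_type D := exist _ (g c) (mem_image g c).
apply: (@prime1 _ P); rewrite -[1](subrK (y * x)); apply: idealD; last exact: idealM.
apply: sub; have -> : val (1 - y * x) = 1 - g c * val x.
  by rewrite rmorphB rmorph1 rmorphM.
have -> : 1 - g c * val x = g (1 - c * r) by rewrite -rE rmorphB rmorph1 rmorphM.
exact/NQE.
Qed.

End ImageQuotient.

(** C is a parameter because the conductor is not always proper. The separation of maximal ideals by
    their contractions makes the contractions incomparable, as the Chinese remainder theorem in R
    requires. *)
Lemma image_presentation (R T : idomainType) (f : {rmorphism R -> T}) (C : ideal T) c0 :
  injective f -> dedekind T -> module_finite f -> Defs.proper C -> C `<=` range f ->
  c0 \ini C -> c0 != 0 ->
  (forall N N' : maximal_ideal T, C `<=` N -> C `<=` N' ->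
    (forall r, f r \ini N <-> f r \ini N') -> N = N') ->
  exists n (N : 'I_n -> maximal_ideal T) (a : 'I_n -> nat)
    (D : forall i, subringClosed (quot_ring (ideal_exp (N i) (a i)))),
    pullback_presentation f D.
Proof.
move=> f_inj dedT finf C1 CR Cc0 c00 Ndist; have [nT _ dT] := dedT.
have intf := module_finite_integral finf.
have [l0 l0P] := finite_maximal nT dT Cc0 c00.
pose l := undup [seq M : {classic maximal_ideal T} <- l0 | `[< C `<=` (M : maximal_ideal T) >]].
have lP (M : maximal_ideal T) : ((M : {classic maximal_ideal T}) \in l) = `[< C `<=` M >].
  rewrite mem_undup mem_filter; case: asboolP => //= CM; exact: l0P.
pose n := size l; pose N (k : 'I_n) : maximal_ideal T := tnth (in_tuple l) k.
have CN k : C `<=` N k by apply/asboolP; rewrite -lP; apply: mem_tnth.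
have Nsurj (M : maximal_ideal T) : C `<=` M -> exists k, M = N k.
  by move=> /asboolP; rewrite -lP => /(tnthP (in_tuple l))[k e]; exists k.
have Ninj : injective N.
  move=> j k e; apply/val_inj/eqP; pose x0 : {classic maximal_ideal T} := N j.
  rewrite -(@nth_uniq _ x0 l) ?ltn_ord ?undup_uniq //.
  by apply/eqP; have := e; rewrite /N !(tnth_nth x0).
have /choice[a aP] k : exists a, (0 < a)%N /\ exists2 s, ~ s \ini N k &
    forall x, x \ini ideal_exp (N k) a -> s * x \ini C.
  have [s [a [Ns sP]]] := primary_power (prime_of_maximal (N k)) nT dT Cc0 c00.
  (* The successor ensures a positive exponent, since [primary_power] may return 0. *)
  exists a.+1; split=> //; exists s => // x Nx; apply: sP.
  exact: ideal_exp_le (leqnSn a) _ Nx.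
have capC t : (forall k, t \ini ideal_exp (N k) (a k)) -> t \ini C.
  (* The ideal C : t lies in no maximal ideal: one containing it contains C, so it is some N k, but
     s is in C : t and outside N k. *)
  move=> Nt; have [qt|/contrapT] := pselect (Defs.proper (quo_elt C t)); last by rewrite /= mul1r.
  have [M qM] := noeth_maximal nT qt.
  have [|k e] := Nsurj M; first by move=> x Cx; apply: qM => /=; apply: idealMr.
  have [_ [s Ns sP]] := aP k; case: Ns; rewrite -e; apply: qM => /=.
  by apply: sP.
exists n, N, a, (fun k => image_closed (quot_pi (ideal_exp (N k) (a k)) \o f)).
have Pm k : is_maximal (ideal_comap f (N k)).
  exact: (integral_comap_maximal intf (maximal_idealP (N k))).
split=> //.
- split=> //; have [M CM] := noeth_maximal nT C1.
  by have [k _] := Nsurj M CM; apply: leq_ltn_trans (ltn_ord k).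
- by move=> k; case: (aP k).
- move=> k; split; last exact: image_module_finite.
  by apply: image_unibranched; [case: (aP k)|].
apply/seteqP; split=> [_ [r _ <-] k|t tD]; first exact: (mem_image (quot_pi _ \o f)).
have /choice[r rP] k : exists r, t - f r \ini ideal_exp (N k) (a k).
  by have /asboolP[r _ /= /esym /quot_piP e] := tD k; exists r.
(* One r' in R approximates t at all N k simultaneously; the error t - f r' lies in C and so comes
   from R. *)
have [|k j kj jk|r' r'P] := @crt R n (fun k => ideal_comap f (N k)) a r.
- exact: Pm.
- move/eqP: kj; apply; apply: Ninj; apply: Ndist => // x.
  split; last exact: jk.
  have [_ jmax] := Pm j; have := jmax _ _ jk; case: (Pm k) => k1 _ /(_ k1) e.
  by move=> Nx; have : x \ini ideal_comap f (N k) by []; rewrite e.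
have [|s _ sE] := CR (t - f r').
  apply: capC => k; have := comap_exp (f := f) (I := ideal_comap f (N k)) (J := N k) (fun x h => h) (r'P k).
  by rewrite rmorphB => h; have := idealB (rP k) h; congr (_ \ini _); ring.
by exists (s + r') => //; rewrite rmorphD sE subrK.
Qed.

Lemma module_finite_of_quot (A B : comPzRingType) (f : {rmorphism A -> B}) (J : ideal B) :
  J `<=` range f -> module_finite (quot_map f J) -> module_finite f.
Proof.
move=> Jf [n [g gP]]; apply/module_finite_gens.
(* The generator 1 accounts for J, which comes from A. *)
exists (1 :: [seq quot_repr (g i) | i : 'I_n]) => S [S0 SD SM] lS t _.
have [c e] := gP (quot_pi J t).
pose u := \sum_i f (quot_repr (c i)) * quot_repr (g i).
have /Jf[r _ rE] : t - u \ini J.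
  apply/quot_piP; rewrite e rmorph_sum; apply: eq_bigr => i _.
  by rewrite rmorphM /= quot_reprK.
rewrite -[t](subrK u) -rE -[f r]mulr1; apply: (SD).
  by apply: (SM); apply: lS; rewrite mem_head.
rewrite /u; elim/big_ind: _ => // i _; apply: SM; apply: lS.
by rewrite inE; apply/orP; right; apply: map_f; rewrite mem_enum.
Qed.

(** The product of the denominators of the generators lies in the conductor. *)
Lemma module_finite_conductor (R : idomainType) : module_finite (@to_intcl R) ->
  exists2 c, to_intcl c \ini conductor_intcl R & c != 0.
Proof.
move=> [n [g gP]]; have /choice[ab abP] k : exists ab : R * R, ab.2 != 0 /\
    intcl_val (g k) = toK ab.1 / toK ab.2.
  by have [a [b ?]] := fracE (intcl_val (g k)); exists (a, b).
have frac_mul (F : fieldType) (p r a b : F) : b != 0 -> r * p * a = b * p * (r * (a / b)).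
  by move=> b0; field.
exists (\prod_k (ab k).2); last by apply/prodf_neq0 => k _; case: (abP k).
move=> _ /intcl_valK[t <-]; have [c ->] := gP t.
exists (\sum_k c k * (\prod_(j | j != k) (ab j).2) * (ab k).1) => //.
rewrite !rmorph_sum mulr_sumr; apply: eq_bigr => k _.
have [bk0 gk] := abP k.
have e : intcl_val (to_intcl (c k) * g k) = toK (c k) * (toK (ab k).1 / toK (ab k).2).
  by rewrite -gk; apply: (rmorphM intcl_val).
transitivity (toK (\prod_j (ab j).2) * (toK (c k) * (toK (ab k).1 / toK (ab k).2))).
  have -> : \prod_j (ab j).2 = (ab k).2 * \prod_(j | j != k) (ab j).2 by rewrite (bigD1 k).
  by rewrite /= !tofracM; apply: frac_mul; rewrite toK_eq0.
by congr (_ * _).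
Qed.

Lemma pullback_of_unibranched (R : idomainType) :
  ~ (forall x : R, x != 0 -> x \is a GRing.unit) -> dedekind (intcl R) ->
  unibranched (quot_map (@to_intcl R) (conductor_intcl R)) ->
  module_finite (quot_map (@to_intcl R) (conductor_intcl R)) ->
  exists n (N : 'I_n -> maximal_ideal (intcl R)) (a : 'I_n -> nat)
    (D : forall i, subringClosed (quot_ring (ideal_exp (N i) (a i)))),
    pullback_presentation (@to_intcl R) D.
Proof.
set i := @to_intcl R; set C := conductor_intcl R => nfR dedT [_ unib] finq.
have CR : C `<=` range i by move=> x /conductor_to_intcl[r ->]; exists r.
have finf := module_finite_of_quot CR finq.
have [c Cc c0] := module_finite_conductor finf.
have i_eq0 x : x != 0 -> i x != 0 by rewrite -(rmorph0 i) (inj_eq (@to_intcl_inj R)).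
have [C1|/contrapT C1] := pselect (Defs.proper C).
  apply: (image_presentation (C := C) (@to_intcl_inj R) dedT finf C1 CR Cc (i_eq0 _ c0)).
  move=> N N' CN CN' NN'; have [Q QE] := quot_prime (Q := prime_of_maximal N) CN.
  have [Q' Q'E] := quot_prime (Q := prime_of_maximal N') CN'.
  have [Q0 [_ Q0u]] := unib (prime_comap (quot_map i C) Q).
  have QQ' : Q = Q'.
    rewrite -(Q0u Q) // -(Q0u Q') //; apply/seteqP.
    split=> x; rewrite -[x]quot_reprK /preimage /= quot_map_pi.
      by move=> /Q'E/NN'/QE.
    by move=> /QE/NN'/Q'E.
  by apply: maximal_ideal_eq => x /QE; rewrite QQ' => /Q'E.
(* Now R = R'. Any maximal ideal containing a nonzero nonunit can take the place of the conductor,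
   and R not being a field provides one. *)
have [x x0 xu] : exists2 x : R, x != 0 & ~~ (x \is a GRing.unit).
  apply: contrapT => nox; apply: nfR => x x0; apply: contrapT => /negP xu.
  by apply: nox; exists x.
have Rx t : exists r, t = i r by apply: conductor_to_intcl; rewrite -[t]mulr1; apply: idealM.
have [|N xN] := @noeth_maximal _ (let: And3 nT _ _ := dedT in nT) (scale_ideal (i x) (unit_ideal _)).
  move=> [t _]; have [y ->] := Rx t; rewrite -to_intclM => /esym/eqP.
  rewrite -(rmorph1 i) (inj_eq (@to_intcl_inj R)) => /eqP xy.
  by case/unitrP: xu; exists y; rewrite mulrC.
apply: (image_presentation (C := N) (@to_intcl_inj R) dedT finf _ _ _ (i_eq0 _ x0)).
- by case: (maximal_idealP N).
- by move=> t _; have [r ->] := Rx t; exists r.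
- by apply: xN; exists 1; rewrite ?mulr1.
- by move=> M M' /maximal_ideal_eq <- /maximal_ideal_eq <-.
Qed.

(** * Rings given by a pullback presentation *)

Section Pullback.
Variables (R T : idomainType) (f : {rmorphism R -> T}).
Variables (n : nat) (N : 'I_n -> maximal_ideal T) (a : 'I_n -> nat).
Variable D : forall i, subringClosed (quot_ring (ideal_exp (N i) (a i))).
Hypothesis nfR : ~ (forall x : R, x != 0 -> x \is a GRing.unit).
Hypothesis pres : pullback_presentation f D.
Local Notation pi k := (quot_pi (ideal_exp (N k) (a k))).

Let dedT : dedekind T. Proof. by case: pres => [[]]. Qed.
Let nT : noetherian T. Proof. by case: dedT. Qed.
Let dT : dim_le1 T. Proof. by case: dedT. Qed.
Let f_inj : injective f. Proof. by case: pres => [[]]. Qed.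
Let n0 : (0 < n)%N. Proof. by case: pres => _ []. Qed.
Let a0 k : (0 < a k)%N. Proof. by case: pres => _ _ + _ _; apply. Qed.

Let rangeP t : range f t <-> forall k, pi k t \in D k.
Proof. by case: pres => _ _ _ _ ->. Qed.

Let N_incomparable k l : k != l -> ~ N l `<=` N k.
Proof.
case: pres => _ [_ Ninj] _ _ _ /eqP kl Nlk; apply: kl; apply: Ninj.
exact/esym/maximal_ideal_eq.
Qed.

(** The kernel of the projection to the product of the T / N_k^a_k; an ideal of T inside R, used in
    place of the conductor. *)
Let C_set : set T := [set t | forall k, t \ini ideal_exp (N k) (a k)].

Let C0 : C_set 0. Proof. by move=> k; apply: ideal0. Qed.
Let CD x y : C_set x -> C_set y -> C_set (x + y).
Proof. by move=> Cx Cy k; apply: idealD. Qed.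
Let CM r x : C_set x -> C_set (r * x).
Proof. by move=> Cx k; apply: idealM. Qed.
Let C : ideal T := Ideal C0 CD CM.

Let pi0 k t : t \ini ideal_exp (N k) (a k) -> pi k t = 0.
Proof. by move=> Nt; rewrite -(rmorph0 (pi k)); apply/quot_piP; rewrite subr0. Qed.

Let CR : C `<=` range f.
Proof. by move=> t Ct; apply/rangeP => k; rewrite pi0 ?rpred0. Qed.

Let idempotent k : exists e, 1 - e \ini ideal_exp (N k) (a k) /\
  forall l, l != k -> e \ini ideal_exp (N l) (a l).
Proof.
apply: crt_idempotent; last exact: N_incomparable.
by move=> l; apply: maximal_idealP.
Qed.

(** R maps onto D_k: multiplying a representative by e makes its other components vanish, so the
    product satisfies every condition defining R. *)
Let lift_component k x : x \in D k -> exists r, f r - quot_repr x \ini ideal_exp (N k) (a k).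
Proof.
move=> Dx; have [e [e1 e0]] := idempotent k.
have /rangeP[r _ rE] l : pi l (e * quot_repr x) \in D l.
  have [->|lk] := eqVneq l k; last by rewrite pi0 ?rpred0 //; apply: idealMr; apply: e0.
  suff -> : pi k (e * quot_repr x) = x by [].
  rewrite -[RHS]quot_reprK; apply/quot_piP.
  by have := idealN (idealMr (quot_repr x) e1); congr (_ \ini _); ring.
exists r; rewrite rE.
by have := idealN (idealMr (quot_repr x) e1); congr (_ \ini _); ring.
Qed.

Lemma pullback_module_finite : module_finite f.
Proof.
apply/module_finite_gens.
have /choice[l lP] k : exists l : seq T, forall S, submodule f S -> (forall x, x \in l -> S x) ->
    forall t, exists2 s, S s & t - s \ini ideal_exp (N k) (a k).
  have [_ _ _ /(_ k)[_ [m [g gP]]] _] := pres.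
  exists [seq quot_repr (g j) | j : 'I_m] => S [S0 SD SM] gS t.
  have [c e] := gP (pi k t); have /choice[r rP] j := lift_component (valP (c j)).
  exists (\sum_j f (r j) * quot_repr (g j)).
    elim/big_ind: _ => // j _; apply: SM; apply: gS.
    by apply: map_f; rewrite mem_enum.
  apply/quot_piP; rewrite e rmorph_sum; apply: eq_bigr => j _.
  rewrite rmorphM /= quot_reprK; congr (_ * _); rewrite -[LHS]quot_reprK.
  by apply/esym/quot_piP; apply: rP.
have /choice[e eP] := idempotent.
(* The elements e k x generate T modulo C, and 1 accounts for C. *)
exists (1 :: flatten [seq [seq e k * x | x <- l k] | k : 'I_n]) => S Ssub lS t _.
have [S0 SD SM] := Ssub.
have /choice[s sP] k : exists s, S (e k * s) /\ t - s \ini ideal_exp (N k) (a k).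
  have [| |s Ss ts] := lP k [set x | S (e k * x)] _ _ t; last by exists s.
    split=> [|x y Sx Sy|b x Sx] /=; first by rewrite mulr0.
      by rewrite mulrDr; apply: (SD).
    by rewrite mulrCA; apply: (SM).
  move=> x xl; apply: lS; rewrite inE; apply/orP; right; apply/flatten_mapP.
  by exists k; rewrite ?mem_enum //; apply: map_f.
have [|r _ rE] := @CR (t - \sum_k e k * s k).
  move=> k; rewrite (bigD1 k) //=; have [e1 _] := eP k; have [_ ts] := sP k.
  have Nl : \sum_(j | j != k) e j * s j \ini ideal_exp (N k) (a k).
    elim/big_ind: _ => [|x y|j jk]; [exact: ideal0|exact: idealD|].
    by apply: idealMr; case: (eP j) => _; apply; rewrite eq_sym.
  have := idealB (idealD (idealMr (s k) e1) ts) Nl.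
  by congr (_ \ini _); ring.
rewrite -[t](subrK (\sum_k e k * s k)); apply: (SD).
  by rewrite -rE -[f r]mulr1; apply: (SM); apply: lS; rewrite mem_head.
by elim/big_ind: _ => // k _; case: (sP k).
Qed.

Let intf := module_finite_integral pullback_module_finite.

(** If N_k were zero, the zero ideal of R would be maximal and R a field. *)
Let N_nonzero k : exists2 b, b \ini N k & b != 0.
Proof.
apply: contrapT => Nz; apply: nfR => x x0.
have Pm := integral_comap_maximal intf (maximal_idealP (N k)).
have Pz r : r \ini ideal_comap f (N k) -> r = 0.
  move=> Nr; apply: f_inj; rewrite rmorph0; apply: contrapT => /eqP fr.
  by apply: Nz; exists (f r).
have [|c /Pz/eqP] := maximal1 Pm (x := x); first by move/Pz/eqP; rewrite (negbTE x0).
by rewrite subr_eq0 => /eqP e; apply/unitrP; exists c; rewrite [x * c]mulrC -e.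
Qed.

Let C_nonzero : exists2 c, c \ini C & c != 0.
Proof.
have /choice[b bP] k : exists b, b \ini N k /\ b != 0.
  by have [b Nb b0] := N_nonzero k; exists b.
exists (\prod_k b k ^+ a k).
  move=> k; rewrite (bigD1 k) //=; apply: idealMr; apply: ideal_expX.
  by case: (bP k).
by apply/prodf_neq0 => k _; rewrite expf_neq0 //; case: (bP k).
Qed.

Lemma pullback_noetherian : noetherian R.
Proof.
have [c Cc c0] := C_nonzero.
exact: noetherian_descent f_inj pullback_module_finite nT dT Cc c0 CR.
Qed.

(** For x in P the ideal x C of T lies in x R, so its contraction lies in P; being nonzero, it
    forces the prime above to be maximal. *)
Lemma pullback_prime_over (P : prime_ideal R) : (exists2 x, x \ini P & x != 0) ->
  exists Q : prime_ideal T, [/\ is_maximal Q, exists2 b, b \ini Q & b != 0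
    & P = prime_comap f Q].
Proof.
move=> [x Px x0]; have [c Cc c0] := C_nonzero; pose J := scale_ideal (f x) C.
have [r|Q [JQ QP]] := lying_over (J := J) (P := P) (f := f) nT.
  move=> [_ /CR[r' _ <-]]; rewrite -rmorphM => /f_inj ->; exact: idealMr.
have Qb : f x * c \ini Q by apply: JQ; exists c.
have b0 : f x * c != 0 by rewrite mulf_neq0 // -(rmorph0 f) (inj_eq f_inj).
have Qm : is_maximal Q by apply: dT; exists (f x * c).
exists Q; split=> //; first by exists (f x * c).
by apply: prime_ideal_eq; apply: maximal_eq => //; apply: integral_comap_maximal.
Qed.

Lemma pullback_dim_le1 : dim_le1 R.
Proof.
move=> P /pullback_prime_over[Q [Qm _ ->]].
exact: integral_comap_maximal.
Qed.

(** If Q is none of the N_k, C has an element s outside Q. Then s T lies in R, so R and T agree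
    locally at Q. *)
Let prime_cases (Q : prime_ideal T) : is_maximal Q ->
  (exists k, Q = prime_of_maximal (N k)) \/
  exists s, ~ s \ini prime_comap f Q /\ forall x, exists r, f r = f s * x.
Proof.
move=> Qm; have [[k ->]|Qn] := pselect (exists k, Q = prime_of_maximal (N k)).
  by left; exists k.
right; have /choice[g gP] k : exists g, g \ini N k /\ ~ g \ini Q.
  apply: contrapT => nog; apply: Qn; exists k; apply: prime_ideal_eq.
  apply: (maximal_eq (maximal_idealP (N k))) => x Nx; apply: contrapT => Qx.
  by apply: nog; exists x.
have Cg : \prod_k g k ^+ a k \ini C.
  move=> k; rewrite (bigD1 k) //=; apply: idealMr; apply: ideal_expX.
  by case: (gP k).
have [s _ sE] := CR Cg; exists s; split.
  rewrite /= /preimage /= sE; elim/big_ind: _ => [|x y|k _]; first exact: prime1.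
    exact: prime_notM.
  by apply: prime_notX; case: (gP k).
move=> x; have [r _ rE] : range f (f s * x) by apply: CR; rewrite sE; apply: idealMr.
by exists r.
Qed.

(** The element e, idempotent modulo C, serves as [s0]: it lies in R, is 1 modulo N_k and multiplies
    N_k^a_k into C. With d = a k the bound 2a + d is 3a. *)
Let saturated_N k (A : ideal R) x m : let P := prime_comap f (prime_of_maximal (N k)) in
  (3 * a k <= m)%N -> A `<=` P -> saturated P A -> x \ini A -> x != 0 -> absprod m A.
Proof.
move=> P am AP sA Ax x0; have Nm := maximal_idealP (N k).
have [b Nb b0] := N_nonzero k; have [e [e1 e0]] := idempotent k.
have expN x' : x' \ini ideal_exp (N k) (a k) -> x' \ini N k.
  by move/(ideal_exp_le (a0 k)); rewrite ideal_exp1.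
have inC t : t \ini ideal_exp (N k) (a k) -> range f (e * t).
  move=> Nt; apply: CR => l; have [->|lk] := eqVneq l k; first exact: idealM.
  by apply: idealMr; apply: e0.
have [s _ sE] : range f e.
  apply/rangeP => l; have [->|lk] := eqVneq l k; last by rewrite pi0 ?rpred0 //; apply: e0.
  suff -> : pi k e = 1 by apply: rpred1.
  rewrite -(rmorph1 (pi k)); apply/esym/quot_piP.
  exact: e1.
apply: (saturated_absprod (f := f) (N := prime_of_maximal (N k)) (b := b) (s0 := s)
  (a := a k) (d := a k) f_inj dedT Nm Nb b0 _ _ _ (leqnn _) (a0 k) _ AP sA Ax x0).
- exact: integral_comap_maximal.
- rewrite /= /preimage /= sE => Ne; case: Nm => N1 _; apply: N1.
  by rewrite /Defs.proper -[1](subrK e); apply: idealD => //; apply: expN.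
- by move=> t /inC[r _ rE]; exists r; rewrite sE.
- by move: am; lia.
Qed.

(** Here a = 0 and d = 1, so the bound 2a + d is 1 and such primes impose nothing on m. *)
Let saturated_other (Q : prime_ideal T) (A : ideal R) b s x m : let P := prime_comap f Q in
  is_maximal Q -> b \ini Q -> b != 0 -> ~ s \ini P ->
  (forall x, exists r, f r = f s * x) ->
  (0 < m)%N -> A `<=` P -> saturated P A -> x \ini A -> x != 0 -> absprod m A.
Proof.
move=> P Qm Qb b0 Ps sR m0 AP sA Ax x0.
apply: (saturated_absprod (f := f) (N := Q) (b := b) (s0 := s)
  (a := 0%N) (d := 1%N) f_inj dedT Qm Qb b0 _ Ps _ _ _ _ AP sA Ax x0) => //.
exact: integral_comap_maximal.
Qed.

Lemma pullback_AF : exists m, AF_property R m.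
Proof.
pose m := (\max_k 3 * a k)%N; have am k : (3 * a k <= m)%N by apply: leq_bigmax.
have m0 : (0 < m)%N by have := am (Ordinal n0); have := a0 (Ordinal n0); lia.
exists m; apply: (AF_local_global pullback_noetherian pullback_dim_le1 m0).
move=> P Pm A AP sA [x Ax x0].
have [|Q [Qm [b Qb b0] PE]] := pullback_prime_over (P := P); first by exists x => //; apply: AP.
rewrite PE in AP sA; have [[k Qk]|[s [Ps sR]]] := prime_cases Qm.
  by rewrite Qk in AP sA; apply: (saturated_N (am k) AP sA Ax x0).
exact: (saturated_other Qm Qb b0 Ps sR m0 AP sA Ax x0).
Qed.

Lemma pullback_AF_local m : (0 < m)%N -> AF_property R m <->
  forall k, AF_property (localization (prime_comap f (prime_of_maximal (N k)))) m.
Proof.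
move=> m0; split=> [AF k|AF]; first exact: AF_property_loc.
apply: (AF_local_global pullback_noetherian pullback_dim_le1 m0).
move=> P Pm A AP sA [x Ax x0].
have [|Q [Qm [b Qb b0] PE]] := pullback_prime_over (P := P); first by exists x => //; apply: AP.
have [[k Qk]|[s [Ps sR]]] := prime_cases Qm; last first.
  by rewrite PE in AP sA; apply: (saturated_other Qm Qb b0 Ps sR m0 AP sA Ax x0).
apply: (AF_property_saturated (P := P)) => //; last by rewrite PE Qk.
move=> y Py.
have [s [l [Ps As]]] := dim1_radical pullback_noetherian pullback_dim_le1 Ax x0 Py.
by exists l; apply: (sA s).
Qed.

(** An element integral over R, moved to the fraction field of T by [horner_frac], lies in T;
    multiplied by c0 it falls into C and hence into R. *)
Lemma pullback_conductor : conductor R <> [set 0].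
Proof.
have [c0 Cc0 c00] := C_nonzero; have [c _ cE] := CR Cc0.
have c_neq0 : c != 0 by apply: contraNneq c00 => c0'; rewrite -cE c0' rmorph0.
move=> Cz; have : conductor R (toK c); last by rewrite Cz => /eqP; rewrite tofrac_eq0 (negbTE c_neq0).
move=> y [p pm py]; have [al [be [be0 yE]]] := fracE y.
have kbe : toK be != 0 by rewrite tofrac_eq0.
have := horner_frac (g := @FracField.tofrac R) p al kbe.
rewrite -yE (rootP py) mulr0 => /eqP; rewrite tofrac_eq0 => /eqP pab.
pose g : {rmorphism R -> {fraction T}} := @FracField.tofrac T \o f.
have gbe : g be != 0 by rewrite /g /= tofrac_eq0 -(rmorph0 f) (inj_eq f_inj).
have := horner_frac p al gbe; rewrite pab rmorph0 => /esym/eqP.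
rewrite mulf_eq0 expf_eq0 (negbTE gbe) andbF orFb => pz.
have [_ icT _] := dedT; have [|t tE] := icT (g al / g be).
  exists (map_poly f p); first exact: monic_map.
  by rewrite -map_poly_comp.
have fal : f al = t * f be.
  by apply: toK_inj; rewrite tofracM -tE divfK.
have [|r _ rE] := @CR (c0 * t); first by apply: idealMr.
exists r => //; rewrite yE mulrA; apply: (canRL (mulfK kbe)).
rewrite -!tofracM; congr toK.
by apply: f_inj; rewrite !rmorphM rE fal cE; ring.
Qed.

End Pullback.

(** * AF-dimension and the equivalence *)

Lemma AFdim_spec (R : comPzRingType) n : AF_property R n ->
  exists m, [/\ AFdim R = m%:Z%:E, AF_property R m & forall k, AF_property R k -> (m <= k)%N].
Proof.
move=> AFn; rewrite /AFdim; case: pselect => [h|[]]; last by exists n; apply/asboolP.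
case: ex_minnP => m /asboolP AFm mmin; exists m; split=> // k AFk.
by apply: mmin; apply/asboolP.
Qed.

Lemma FAF_domainP (R : idomainType) : FAF_domain R <-> exists n, AF_property R n.
Proof.
rewrite /FAF_domain; split=> [|[n /AFdim_spec[m [-> _ _]]]]; last by rewrite ltry.
by rewrite /AFdim; case: pselect => [[n /asboolP AFn] _|]; [exists n|rewrite ltxx].
Qed.

Unset Implicit Arguments.

Theorem proposition40 (R : idomainType)
    (R_not_field : ~ (forall x : R, x != 0 -> x \is a GRing.unit)) :
  [<-> [/\ noetherian R, FAF_domain R & conductor R <> [set 0]];
       exists (T : idomainType) (iota : {rmorphism R -> T})
         (n : nat) (N : 'I_n -> maximal_ideal T) (a : 'I_n -> nat)
         (D : forall i, subringClosed (quot_ring (ideal_exp (N i) (a i)))),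
         pullback_presentation iota D;
       [/\ dedekind (intcl R),
           unibranched (quot_map (@to_intcl R) (conductor_intcl R))
         & module_finite (quot_map (@to_intcl R) (conductor_intcl R))]]
  /\
  ([/\ noetherian R, FAF_domain R & conductor R <> [set 0]] ->
     module_finite (@to_intcl R) /\
     forall (T : idomainType) (iota : {rmorphism R -> T})
       (n : nat) (N : 'I_n -> maximal_ideal T) (a : 'I_n -> nat)
       (D : forall i, subringClosed (quot_ring (ideal_exp (N i) (a i)))),
       pullback_presentation iota D ->
       AFdim R = \big[maxe/-oo%E]_(i < n)
         AFdim (localization (prime_comap iota (prime_of_maximal (N i))))).
Proof.
(* Finiteness of R' over R is kept rather than only that of the quotient, since the last claim needs
   it. *)
have c13 : [/\ noetherian R, FAF_domain R & conductor R <> [set 0]] ->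
    [/\ dedekind (intcl R), unibranched (quot_map (@to_intcl R) (conductor_intcl R))
      & module_finite (@to_intcl R)].
  move=> [nR /FAF_domainP[n AFn] Cn0].
  have [dedR finR] := intcl_structure nR (AF_dim1 nR AFn) Cn0.
  by split=> //; apply: AF_intcl_unibranched AFn Cn0.
have c32 : [/\ dedekind (intcl R), unibranched (quot_map (@to_intcl R) (conductor_intcl R))
      & module_finite (quot_map (@to_intcl R) (conductor_intcl R))] ->
    exists (T : idomainType) (iota : {rmorphism R -> T})
      (n : nat) (N : 'I_n -> maximal_ideal T) (a : 'I_n -> nat)
      (D : forall i, subringClosed (quot_ring (ideal_exp (N i) (a i)))),
      pullback_presentation iota D.
  move=> [dedR unib finq].
  have [n [N [a [D pres]]]] := pullback_of_unibranched R_not_field dedR unib finq.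
  by exists (intcl R), (@to_intcl R), n, N, a, D.
have c21 : (exists (T : idomainType) (iota : {rmorphism R -> T})
      (n : nat) (N : 'I_n -> maximal_ideal T) (a : 'I_n -> nat)
      (D : forall i, subringClosed (quot_ring (ideal_exp (N i) (a i)))),
      pullback_presentation iota D) ->
    [/\ noetherian R, FAF_domain R & conductor R <> [set 0]].
  move=> [T [f [n [N [a [D pres]]]]]]; split.
  - exact: pullback_noetherian R_not_field pres.
  - by apply/FAF_domainP; apply: pullback_AF R_not_field pres.
  - exact: pullback_conductor R_not_field pres.
have c13' c1 := let: And3 dedR unib finR := c13 c1 in
  And3 dedR unib (module_finite_quot (conductor_intcl R) finR).
split; first by tfae; [move/c13'/c32|move/c21/c13'|move/c32/c21].
move=> c1; split=> [|T f n N a D pres]; first by case: (c13 c1).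
have [_ /FAF_domainP[m0 AFm0] _] := c1.
have [m [-> AFm mmin]] := AFdim_spec AFm0.
have AFloc k : (0 < k)%N -> AF_property R k <-> forall i : 'I_n,
    AF_property (localization (prime_comap f (prime_of_maximal (N i)))) k.
  exact: pullback_AF_local R_not_field pres k.
have m_gt0 : (0 < m)%N by case: AFm.
have /choice[d dP] i := AFdim_spec ((AFloc m m_gt0).1 AFm i).
have n_gt0 : (0 < n)%N by case: pres => _ [].
have [i0 i0max] : exists i0 : 'I_n, forall i, (d i <= d i0)%N.
  have [|i0 e] := @bigop.eq_bigmax _ d; first by rewrite card_ord.
  by exists i0 => i; rewrite -e; apply: leq_bigmax.
have dm i : (d i <= m)%N.
  by have [_ _] := dP i; apply; apply: (AFloc m m_gt0).1.
have md : (m <= d i0)%N.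
  (* The property is monotone in the exponent, so at the largest [d i] it holds for all
     localizations at once and therefore for R. *)
  apply: mmin; have [_ [d0 _] _] := dP i0; apply/(AFloc _ d0) => i.
  by have [_ AFd _] := dP i; apply: AF_property_le AFd.
apply/eqP; rewrite eq_le; apply/andP; split.
  apply: (bigmax_sup i0) => //; have [-> _ _] := dP i0.
  by rewrite lee_fin lez_nat.
apply/bigmax_leP; split=> [|i _]; first by rewrite leNye.
by have [-> _ _] := dP i; rewrite lee_fin lez_nat.
Qed.
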